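(* Let $U$ be a Vaught theory and let $N,M$ be interpretations of ${\sf Succ}_0$ in $U$. Then ${\sf TB}^-_N$ and ${\sf TB}^-_M$ are mutually Fujimoto interpretable over $U$. Consequently $U$ is $M$-Enayat iff $U$ is $N$-Enayat.
   Context: ${\sf Succ}_0$ has a constant $0$ and a binary predicate ${\sf S}$; with $\widetilde0(x):=(x=0)$ and $\widetilde{n+1}(x):=\exists y\,(\widetilde n(y)\wedge y\,{\sf S}\,x)$ its axioms are $\exists x\,\widetilde n(x)$, $\neg(\widetilde m(x)\wedge\widetilde n(x))$ for $m<n$, and $(\widetilde n(x)\wedge\widetilde n(y))\to x=y$. For an (possibly multidimensional, say $k$-dimensional) interpretation $N$ of ${\sf Succ}_0$ in $U$, with domain $\delta_N$, extend the signature of $U$ by a fresh $k$-ary predicate ${\sf T}$ and write ${\sf T}(\underline n)$ for $\exists\vec x\in\delta_N(\widetilde n^N(\vec x)\wedge{\sf T}(\vec x))$. ${\sf TB}^-_N$ is the set of sentences $A\leftrightarrow{\sf T}(\underline{\ulcorner A\urcorner})$ for all $U$-sentences $A$, where $\ulcorner A\urcorner$ is the number of $A$ under a fixed standard Gödel numbering. $U$ is $N$-Enayat iff $U$ interprets $U+{\sf TB}^-_N$. A theory $U$ is Vaught if it directly (unrelativized, identity-preserving, possibly multidimensional) interprets ${\sf VS}$ (Vaught set theory: $\exists x\forall y\,y\notin x$ and, for each $n$, $\forall u_0\dots u_{n-1}\exists x\forall y(y\in x\leftrightarrow\bigvee_{i<n}y=u_i)$). For sets $\Gamma,\Delta$ of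 sentences in signatures extending that of $U$, $\Gamma$ Fujimoto interprets $\Delta$ over $U$ ($\Gamma\blacktriangleright_U\Delta$) iff there is an identity-preserving, unrelativized interpretation of $U+\Delta$ in $U+\Gamma$ that translates every symbol of the signature of $U$ as itself; mutual Fujimoto interpretability means both directions hold. *)

(* Defs.v *)
From HB Require Import structures.
From Stdlib Require List.
From Stdlib Require Import FunctionalExtensionality.
From mathcomp Require Import all_boot.

Set Implicit Arguments.
Unset Strict Implicit.
Unset Printing Implicit Defensive.

Record signature := Signature {
  funs : countType;
  rels : countType;
  far : funs -> nat;
  rar : rels -> nat
}.

(* [term L V] and [form L V] have their free variables in the type [V];
   [All] binds the variable [None] of [option V]. Hence [form L void] is the
   type of sentences, and a formula in the variables x_0, ..., x_(k-1) is an
   element of [form L 'I_k]. *)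
Inductive term (L : signature) (V : Type) : Type :=
| Var (v : V)
| App (f : funs L) (ts : 'I_(far f) -> term L V).

Inductive form (L : signature) (V : Type) : Type :=
| Bot
| Eq (s t : term L V)
| Rel (r : rels L) (ts : 'I_(rar r) -> term L V)
| Imp (A B : form L V)
| All (A : form L (option V)).

Arguments Var {L V} v.
Arguments App {L V} f ts.
Arguments Bot {L V}.
Arguments Eq {L V} s t.
Arguments Rel {L V} r ts.
Arguments Imp {L V} A B.
Arguments All {L V} A.

Definition sentence (L : signature) : Type := form L void.
Definition theory (L : signature) : Type := sentence L -> Prop.

Section Connectives.
Context {L : signature}.

Definition Top {V : Type} : form L V := Imp Bot Bot.
Definition Neg {V : Type} (A : form L V) : form L V := Imp A Bot.
Definition And {V : Type} (A B : form L V) : form L V := Neg (Imp A (Neg B)).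
Definition Or {V : Type} (A B : form L V) : form L V := Imp (Neg A) B.
Definition Iff {V : Type} (A B : form L V) : form L V :=
  And (Imp A B) (Imp B A).
Definition Ex {V : Type} (A : form L (option V)) : form L V :=
  Neg (All (Neg A)).
Definition AndN {V : Type} n (F : 'I_n -> form L V) : form L V :=
  foldr And Top [seq F i | i <- enum 'I_n].
Definition OrN {V : Type} n (F : 'I_n -> form L V) : form L V :=
  foldr Or Bot [seq F i | i <- enum 'I_n].

End Connectives.

Section Substitution.
Context {L : signature}.

Fixpoint rename_term (V W : Type) (f : V -> W) (t : term L V) : term L W :=
  match t with
  | Var v => Var (f v)
  | App g ts => App g (fun i => rename_term f (ts i))
  end.

Fixpoint rename (V W : Type) (f : V -> W) (A : form L V) : form L W :=
  match A with
  | Bot => Bot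
  | Eq s t => Eq (rename_term f s) (rename_term f t)
  | Rel r ts => Rel r (fun i => rename_term f (ts i))
  | Imp A B => Imp (rename f A) (rename f B)
  | All A => All (rename (omap f) A)
  end.

Fixpoint subst_term (V W : Type) (s : V -> term L W) (t : term L V) :
    term L W :=
  match t with
  | Var v => s v
  | App g ts => App g (fun i => subst_term s (ts i))
  end.

Definition up (V W : Type) (s : V -> term L W) (v : option V) :
    term L (option W) :=
  if v is Some v' then rename_term Some (s v') else Var None.

Fixpoint subst (V W : Type) (s : V -> term L W) (A : form L V) : form L W :=
  match A with
  | Bot => Bot
  | Eq t u => Eq (subst_term s t) (subst_term s u)
  | Rel r ts => Rel r (fun i => subst_term s (ts i))
  | Imp A B => Imp (subst s A) (subst s B)
  | All A => All (subst (up s) A)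
  end.

Definition inst (V : Type) (A : form L (option V)) (t : term L V) : form L V :=
  subst (fun v => if v is Some v' then Var v' else t) A.

End Substitution.

(* Classical natural deduction. [nd T G A] is derivability of [A] from the
   hypotheses [G], all with free variables in [V], and the axioms [T].
   In a context [V] without closed terms the quantifier rules do not yield
   that the domain is inhabited; [nd_inhabited] is the usual convention of
   first-order logic that it is. *)
Inductive nd (L : signature) (T : theory L) :
  forall V : Type, seq (form L V) -> form L V -> Prop :=
| nd_axiom V (G : seq (form L V)) (A : sentence L) :
    T A -> nd T G (rename (of_void V) A)
| nd_hyp V (G : seq (form L V)) A :
    List.In A G -> nd T G A
| nd_imp_intro V (G : seq (form L V)) A B :
    nd T (A :: G) B -> nd T G (Imp A B)
| nd_imp_elim V (G : seq (form L V)) A B :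
    nd T G (Imp A B) -> nd T G A -> nd T G B
| nd_raa V (G : seq (form L V)) A :
    nd T (Neg A :: G) Bot -> nd T G A
| nd_all_intro V (G : seq (form L V)) (A : form L (option V)) :
    nd T (map (rename Some) G) A -> nd T G (All A)
| nd_all_elim V (G : seq (form L V)) (A : form L (option V)) t :
    nd T G (All A) -> nd T G (inst A t)
| nd_eq_refl V (G : seq (form L V)) t :
    nd T G (Eq t t)
| nd_eq_elim V (G : seq (form L V)) (A : form L (option V)) s t :
    nd T G (Eq s t) -> nd T G (inst A s) -> nd T G (inst A t)
| nd_inhabited V (G : seq (form L V)) A :
    nd T (map (rename (@Some V)) G) (rename (@Some V) A) -> nd T G A.

Definition proves (L : signature) (T : theory L) (A : sentence L) : Prop :=
  nd T [::] A.

Section Blocks.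
Context {L : signature}.

Definition ord0_elim (T : Type) (i : 'I_0) : T :=
  let: Ordinal _ lt_i0 := i in False_rect T (notF lt_i0).

Fixpoint all_ord (n : nat) (V : Type) : form L (V + 'I_n) -> form L V :=
  match n with
  | 0 => rename (fun x => match x with inl v => v | inr i => ord0_elim V i end)
  | n'.+1 => fun A => all_ord (All (rename
      (fun x : V + 'I_n'.+1 => match x with
         | inl v => Some (inl v)
         | inr i => omap inr (unlift ord0 i)
         end) A))
  end.

Definition all_block (I : finType) (V : Type) (A : form L (V + I)) : form L V :=
  all_ord (rename
    (fun x => match x with inl v => inl v | inr i => inr (enum_rank i) end) A).

Definition ex_block (I : finType) (V : Type) (A : form L (V + I)) : form L V :=
  Neg (all_block (Neg A)).

End Blocks.

(* A [k]-dimensional parameter-free relative translation of [L] into [L'].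
   The variable [(i, j)] is the [j]-th component of the [i]-th argument; in
   [tr_eq] the two arguments are [false] and [true]; [tr_fun f] defines the
   graph of [f], its value being the argument [None]. *)
Record translation (k : nat) (L L' : signature) := Translation {
  tr_dim_gt0 : 0 < k;
  tr_dom : form L' 'I_k;
  tr_eq : form L' (bool * 'I_k);
  tr_rel : forall r : rels L, form L' ('I_(rar r) * 'I_k);
  tr_fun : forall f : funs L, form L' (option 'I_(far f) * 'I_k)
}.

Section Translate.
Context {k : nat} {L L' : signature} (K : translation k L L').

Definition tuple_eq (W : Type) (x y : 'I_k -> W) : form L' W :=
  AndN (fun j => Eq (Var (x j)) (Var (y j))).

Definition in_dom (W : Type) (x : 'I_k -> W) : form L' W := rename x (tr_dom K).

(* Function symbols are eliminated by unwinding terms: [tr_value t e x] says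
   that the tuple [x] is a value of the term [t], where the variable [v] of
   [t] is translated to the tuple [e v]. *)
Fixpoint tr_value (V : Type) (t : term L V) (W : Type)
    (e : V -> 'I_k -> W) (x : 'I_k -> W) : form L' W :=
  match t with
  | Var v => tuple_eq (e v) x
  | App f ts =>
      ex_block (I := ('I_(far f) * 'I_k)%type)
        (And (AndN (fun i => And (in_dom (fun j => inr (i, j)))
                (tr_value (ts i) (fun v j => inl (e v j))
                                 (fun j => inr (i, j)))))
             (rename (fun p => if p.1 is Some i then inr (i, p.2)
                               else inl (x p.2))
                     (tr_fun K f)))
  end.

Fixpoint tr_form (V : Type) (A : form L V) (W : Type)
    (e : V -> 'I_k -> W) : form L' W :=
  match A with
  | Bot => Bot
  | Eq s t =>
      ex_block (I := (bool * 'I_k)%type)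
        (And (And (in_dom (fun j => inr (false, j)))
                  (tr_value s (fun v j => inl (e v j))
                              (fun j => inr (false, j))))
        (And (And (in_dom (fun j => inr (true, j)))
                  (tr_value t (fun v j => inl (e v j))
                              (fun j => inr (true, j))))
             (rename inr (tr_eq K))))
  | Rel r ts =>
      ex_block (I := ('I_(rar r) * 'I_k)%type)
        (And (AndN (fun i => And (in_dom (fun j => inr (i, j)))
                (tr_value (ts i) (fun v j => inl (e v j))
                                 (fun j => inr (i, j)))))
             (rename inr (tr_rel K r)))
  | Imp A B => Imp (tr_form A e) (tr_form B e)
  | All A =>
      all_block (I := 'I_k)
        (Imp (in_dom inr)
             (tr_form A (fun v j => if v is Some v' then inl (e v' j)
                                    else inr j)))
  end.

Definition tr_sentence (A : sentence L) : sentence L' :=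
  tr_form A (fun v : void => match v with end).

Definition unrelativized : Prop := tr_dom K = Top.

Definition identity_preserving : Prop :=
  tr_eq K = AndN (fun j => Eq (Var (false, j)) (Var (true, j))).

(* [K] is an interpretation of [T] in [U]. Applied to the logical theorems of
   [T], this includes that the domain is nonempty, that [tr_eq K] is a
   congruence, and that the [tr_fun K f] are total and functional. *)
Definition is_interpretation (T : theory L) (U : theory L') : Prop :=
  forall A : sentence L, proves T A -> proves U (tr_sentence A).

End Translate.

(* [interprets U T]: [U] interprets [T]. *)
Definition interprets (L L' : signature) (U : theory L') (T : theory L) :
    Prop :=
  exists k, exists K : translation k L L', is_interpretation K T U.

Definition directly_interprets (L L' : signature) (U : theory L')
    (T : theory L) : Prop :=
  exists k, exists K : translation k L L',
    [/\ unrelativized K, identity_preserving K & is_interpretation K T U].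

(* A signature extending [L], presented by its additional symbols [X]. *)
Definition sig_ext (L X : signature) : signature :=
  {| funs := (funs L + funs X)%type;
     rels := (rels L + rels X)%type;
     far := fun f => match f with inl g => far g | inr g => far g end;
     rar := fun r => match r with inl s => rar s | inr s => rar s end |}.

Section Extension.
Context {L X : signature}.

Fixpoint expand_term (V : Type) (t : term L V) : term (sig_ext L X) V :=
  match t with
  | Var v => Var v
  | App f ts => @App (sig_ext L X) V (inl f) (fun i => expand_term (ts i))
  end.

Fixpoint expand (V : Type) (A : form L V) : form (sig_ext L X) V :=
  match A with
  | Bot => Bot
  | Eq s t => Eq (expand_term s) (expand_term t)
  | Rel r ts => @Rel (sig_ext L X) V (inl r) (fun i => expand_term (ts i))
  | Imp A B => Imp (expand A) (expand B)
  | All A => All (expand A)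
  end.

Definition add_theory (U : theory L) (Gamma : theory (sig_ext L X)) :
    theory (sig_ext L X) :=
  fun A => (exists2 B, U B & A = expand B) \/ Gamma A.

End Extension.

Section Fujimoto.
Context {L X Y : signature}.

Definition fixes_base (K : translation 1 (sig_ext L Y) (sig_ext L X)) : Prop :=
  (forall r : rels L, tr_rel K (inl r) =
     @Rel (sig_ext L X) _ (inl r) (fun i => Var (i, ord0))) /\
  (forall f : funs L, tr_fun K (inl f) =
     Eq (@App (sig_ext L X) _ (inl f) (fun i => Var (Some i, ord0)))
        (Var (None, ord0))).

(* Gamma Fujimoto interprets Delta over U. As the symbols of [L] are translated
   as themselves, the interpretation is one-dimensional. *)
Definition fujimoto_interprets (U : theory L)
    (Gamma : theory (sig_ext L X)) (Delta : theory (sig_ext L Y)) : Prop :=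
  exists K : translation 1 (sig_ext L Y) (sig_ext L X),
    [/\ unrelativized K, identity_preserving K, fixes_base K
      & is_interpretation K (add_theory U Delta) (add_theory U Gamma)].

End Fujimoto.

Definition mutually_fujimoto_interpretable (L X Y : signature) (U : theory L)
    (Gamma : theory (sig_ext L X)) (Delta : theory (sig_ext L Y)) : Prop :=
  fujimoto_interprets U Gamma Delta /\ fujimoto_interprets U Delta Gamma.

Definition succ_sig : signature :=
  {| funs := unit; rels := unit; far := fun=> 0; rar := fun=> 2 |}.

Definition zero (V : Type) : term succ_sig V :=
  @App succ_sig V tt (ord0_elim _).

Definition succ (V : Type) (s t : term succ_sig V) : form succ_sig V :=
  @Rel succ_sig V tt (fun i => if val i == 0 then s else t).

Fixpoint numeral (n : nat) (V : Type) (x : V) : form succ_sig V :=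
  match n with
  | 0 => Eq (Var x) (zero V)
  | n'.+1 => Ex (And (numeral n' None) (succ (Var None) (Var (Some x))))
  end.

Inductive Succ0 : theory succ_sig :=
| Succ0_exists n : Succ0 (Ex (numeral n None))
| Succ0_disjoint m n : m < n ->
    Succ0 (All (Neg (And (numeral m None) (numeral n None))))
| Succ0_unique n :
    Succ0 (All (All (Imp (And (numeral n (Some None)) (numeral n None))
                         (Eq (Var (Some None)) (Var None))))).

Definition set_sig : signature :=
  {| funs := void; rels := unit; far := of_void nat; rar := fun=> 2 |}.

Definition mem_in (V : Type) (x y : V) : form set_sig V :=
  @Rel set_sig V tt (fun i => Var (if val i == 0 then x else y)).

Inductive VS : theory set_sig :=
| VS_empty : VS (Ex (All (Neg (mem_in None (Some None)))))
| VS_set n :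
    VS (all_block (I := 'I_n)
         (Ex (All (Iff (mem_in None (Some None))
            (OrN (fun i : 'I_n =>
               Eq (Var None) (Var (Some (Some (inr i)))))))))).

Definition Vaught (L : signature) (U : theory L) : Prop :=
  directly_interprets U VS.

(* Formulas are first written as finite trees, with bound variables as
   de Bruijn indices and symbols as their numbers in the signature. *)
Section Goedel.
Context {L : signature}.

Fixpoint code_term (V : Type) (e : V -> nat) (t : term L V) :
    GenTree.tree nat :=
  match t with
  | Var v => GenTree.Leaf (e v)
  | App f ts =>
      GenTree.Node (pickle f) [seq code_term e (ts i) | i <- enum 'I_(far f)]
  end.

Fixpoint code_form (V : Type) (e : V -> nat) (A : form L V) :
    GenTree.tree nat :=
  match A with
  | Bot => GenTree.Node 0 [::]
  | Eq s t => GenTree.Node 1 [:: code_term e s; code_term e t]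
  | Imp A B => GenTree.Node 2 [:: code_form e A; code_form e B]
  | All A =>
      GenTree.Node 3 [:: code_form (fun v => if v is Some v' then (e v').+1
                                             else 0) A]
  | Rel r ts =>
      GenTree.Node (4 + pickle r)
        [seq code_term e (ts i) | i <- enum 'I_(rar r)]
  end.

Definition goedel (A : sentence L) : nat :=
  pickle (code_form (of_void nat) A).

Lemma code_args_inj n T (c d : 'I_n -> T) :
  [seq c i | i <- enum 'I_n] = [seq d i | i <- enum 'I_n] -> c =1 d.
Proof. by move=> /eq_in_map cd i; apply: cd; rewrite mem_enum. Qed.

Lemma code_term_inj (V : Type) (e : V -> nat) :
  injective e -> injective (code_term e).
Proof.
move=> e_inj; elim=> [v|f ts IH] [w|g us] //=.
  by case=> /e_inj ->.
case=> /(pcan_inj pickleK) fg; subst g => /code_args_inj tsus.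
by congr App; apply: functional_extensionality => i; apply: IH.
Qed.

Lemma code_form_inj (V : Type) (e : V -> nat) :
  injective e -> injective (code_form e).
Proof.
move=> e_inj A; elim: A e e_inj => {V}
  [V|V s t|V r ts|V A IHA B IHB|V A IHA] e e_inj [|s' t'|r' ts'|A' B'|A'] //=.
- by case=> /(code_term_inj e_inj) -> /(code_term_inj e_inj) ->.
- case=> /(pcan_inj pickleK) rr'; subst r' => /code_args_inj tsts'.
  by congr Rel; apply: functional_extensionality => i;
     apply: code_term_inj (tsts' i).
- by case=> /(IHA _ e_inj) -> /(IHB _ e_inj) ->.
- by case=> /IHA -> // [v|] [w|] //= [] /e_inj ->.
Qed.

Lemma goedel_inj : injective goedel.
Proof.
by move=> A B /(pcan_inj pickleK) /code_form_inj -> // [].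
Qed.

End Goedel.

Definition truth_sig (k : nat) : signature :=
  {| funs := void; rels := unit; far := of_void nat; rar := fun=> k |}.

Section Tarski.
Context {L : signature} {k : nat} (N : translation k succ_sig L).

Definition truth_atom (V : Type) (x : 'I_k -> V) :
    form (sig_ext L (truth_sig k)) V :=
  @Rel (sig_ext L (truth_sig k)) V (inr tt) (fun j => Var (x j)).

Definition truth_num (n : nat) : sentence (sig_ext L (truth_sig k)) :=
  let x : 'I_k -> void + 'I_k := inr in
  ex_block (And (expand (in_dom N x))
           (And (expand (tr_form N (numeral n tt) (fun=> x))) (truth_atom x))).

Definition TBminus : theory (sig_ext L (truth_sig k)) :=
  fun B => exists A : sentence L, B = Iff (expand A) (truth_num (goedel A)).

Definition Enayat (U : theory L) : Prop := interprets U (add_theory U TBminus).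

End Tarski.

(* Main.v *)
(* Everything is reduced to statements about models by soundness and
   completeness. An interpretation of [T] in [U] yields in each model of [U] an
   internal model of [T], the quotient of the tuples in the domain by the
   translated equality; a translated sentence holds iff it is true there.

   A number of [M] is declared true if some finite set of pairs of an
   [N]-number and an [M]-number, coded in Vaught set theory, contains a pair of
   zeros, contains with each pair a successor of it in both components unless
   the [M]-component is the given number, and pairs the given number only with
   a number that is true in the sense of [N]. For each standard number such a
   set must run in parallel through the numerals of [N] and [M], and one
   exists because Vaught set theory has all sets of standard finite size.

   Enayat's property is then transferred by composing interpretations. *)

From Stdlib Require Import Classical ClassicalEpsilon.
From Stdlib Require Import FunctionalExtensionality PropExtensionality.
Require Import Defs.
From mathcomp Require Import all_boot.

Set Implicit Arguments.
Unset Strict Implicit.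
Unset Printing Implicit Defensive.

(** * Substitution *)

(** Neither [Succ0] nor [VS] has induction, and the numbers of a model of [U] may be nonstandard, so
    nothing is claimed about the transferred predicate at nonstandard arguments. None is needed:
    [TBminus] mentions truth only at numerals, and for a standard number the chain can be followed
    from zero by induction outside the theory. For the same reason a coded set may contain
    irrelevant pairs: beyond the walk from zero only the pairs ending at the given number matter.

    A truth predicate need not respect the translated equality, since T at a numeral asks only for
    some tuple that denotes the number and satisfies T. So chains are compared with their end points
    up to translated equality, whereas T is asked of the quantified tuple itself.

    Directness of the interpretation of [VS] is what allows arbitrary elements of the model to be
    collected: every tuple is then a set-theoretic object, and distinct tuples are distinct objects.

    Working in models avoids writing a separate formal derivation for each standard number. *)

Section SubstitutionLemmas.
Context {L : signature}.

Lemma rename_term_comp (V W Z : Type) (f : V -> W) (g : W -> Z)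
    (t : term L V) :
  rename_term g (rename_term f t) = rename_term (g \o f) t.
Proof.
elim: t => [//|h ts IH] /=; congr App.
by apply: functional_extensionality => i; apply: IH.
Qed.

Lemma omap_compE (V W Z : Type) (f : V -> W) (g : W -> Z) :
  omap g \o omap f = omap (g \o f).
Proof. by apply: functional_extensionality; case. Qed.

Lemma rename_comp (V W Z : Type) (f : V -> W) (g : W -> Z) (A : form L V) :
  rename g (rename f A) = rename (g \o f) A.
Proof.
elim: A W Z f g => {V} [//|V s t|V r ts|V A IHA B IHB|V A IHA] W Z f g /=.
- by rewrite !rename_term_comp.
- by congr Rel; apply: functional_extensionality => i; rewrite rename_term_comp.
- by rewrite IHA IHB.
- by rewrite IHA omap_compE.
Qed.

Lemma subst_rename_term (V W Z : Type) (f : V -> W) (s : W -> term L Z)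
    (t : term L V) :
  subst_term s (rename_term f t) = subst_term (s \o f) t.
Proof.
elim: t => [//|h ts IH] /=; congr App.
by apply: functional_extensionality => i; apply: IH.
Qed.

Lemma subst_rename (V W Z : Type) (f : V -> W) (s : W -> term L Z)
    (A : form L V) :
  subst s (rename f A) = subst (s \o f) A.
Proof.
elim: A W Z f s => {V} [//|V u t|V r ts|V A IHA B IHB|V A IHA] W Z f s /=.
- by rewrite !subst_rename_term.
- by congr Rel; apply: functional_extensionality => i; rewrite subst_rename_term.
- by rewrite IHA IHB.
- rewrite IHA; congr (All (subst _ A)).
  by apply: functional_extensionality; case.
Qed.

Lemma rename_subst_term (V W Z : Type) (s : V -> term L W) (f : W -> Z)
    (t : term L V) :
  rename_term f (subst_term s t) = subst_term (rename_term f \o s) t.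
Proof.
elim: t => [//|h ts IH] /=; congr App.
by apply: functional_extensionality => i; apply: IH.
Qed.

Lemma rename_subst (V W Z : Type) (s : V -> term L W) (f : W -> Z)
    (A : form L V) :
  rename f (subst s A) = subst (rename_term f \o s) A.
Proof.
elim: A W Z s f => {V} [//|V u t|V r ts|V A IHA B IHB|V A IHA] W Z s f /=.
- by rewrite !rename_subst_term.
- by congr Rel; apply: functional_extensionality => i; rewrite rename_subst_term.
- by rewrite IHA IHB.
- rewrite IHA; congr (All (subst _ A)).
  apply: functional_extensionality; case=> [v|//] /=.
  by rewrite !rename_term_comp.
Qed.

Lemma subst_term_comp (V W Z : Type) (s : V -> term L W) (s' : W -> term L Z)
    (t : term L V) :
  subst_term s' (subst_term s t) = subst_term (subst_term s' \o s) t.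
Proof.
elim: t => [//|h ts IH] /=; congr App.
by apply: functional_extensionality => i; apply: IH.
Qed.

Lemma subst_comp (V W Z : Type) (s : V -> term L W) (s' : W -> term L Z)
    (A : form L V) :
  subst s' (subst s A) = subst (subst_term s' \o s) A.
Proof.
elim: A W Z s s' => {V} [//|V u t|V r ts|V A IHA B IHB|V A IHA] W Z s s' /=.
- by rewrite !subst_term_comp.
- by congr Rel; apply: functional_extensionality => i; rewrite subst_term_comp.
- by rewrite IHA IHB.
- rewrite IHA; congr (All (subst _ A)).
  apply: functional_extensionality; case=> [v|//] /=.
  by rewrite subst_rename_term rename_subst_term.
Qed.

Lemma subst_term_Var (V : Type) (t : term L V) : subst_term Var t = t.
Proof.
elim: t => [//|h ts IH] /=; congr App.
by apply: functional_extensionality => i; apply: IH.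
Qed.

Lemma subst_Var (V W : Type) (f : V -> W) (A : form L V) :
  subst (Var \o f) A = rename f A.
Proof.
have tE V' W' (g : V' -> W') (t : term L V') :
    subst_term (Var \o g) t = rename_term g t.
  elim: t => [//|h ts IH] /=; congr App.
  by apply: functional_extensionality => i; apply: IH.
elim: A W f => {V} [//|V u t|V r ts|V A IHA B IHB|V A IHA] W f /=.
- by rewrite !tE.
- by congr Rel; apply: functional_extensionality => i; rewrite tE.
- by rewrite IHA IHB.
- rewrite -IHA; congr (All (subst _ A)).
  by apply: functional_extensionality; case.
Qed.

Lemma rename_id (V : Type) (A : form L V) : rename id A = A.
Proof.
have tE V' (t : term L V') : rename_term id t = t.
  elim: t => [//|h ts IH] /=; congr App.
  by apply: functional_extensionality => i; apply: IH.
elim: A => {V} [//|V u t|V r ts|V A IHA B IHB|V A IHA] /=.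
- by rewrite !tE.
- by congr Rel; apply: functional_extensionality => i; rewrite tE.
- by rewrite IHA IHB.
- rewrite -[in RHS]IHA; congr (All (rename _ A)).
  by apply: functional_extensionality; case.
Qed.

Lemma inst_subst_up (V W : Type) (s : V -> term L W) (A : form L (option V)) t :
  inst (subst (up s) A) t = subst (oapp s t) A.
Proof.
rewrite /inst subst_comp; congr (subst _ A).
apply: functional_extensionality; case=> [v|//] /=.
by rewrite subst_rename_term -[RHS]subst_term_Var.
Qed.

Lemma rename_inst (V W : Type) (f : V -> W) (A : form L (option V)) t :
  rename f (inst A t) = inst (rename (omap f) A) (rename_term f t).
Proof.
rewrite /inst rename_subst subst_rename; congr (subst _ A).
by apply: functional_extensionality; case.
Qed.

End SubstitutionLemmas.

Lemma eq_from_void (T : Type) (f g : void -> T) : f = g.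
Proof. by apply: functional_extensionality; case. Qed.

(** Arbitrary renamings are allowed, also non-injective ones: one use turns a fresh variable into a
    bound one, another merges all variables into a single one. *)
Lemma rename_nd (L : signature) (T : theory L) (V W : Type) (f : V -> W)
    (G : seq (form L V)) A :
  nd T G A -> nd T (map (rename f) G) (rename f A).
Proof.
have shift V' W' (g : V' -> W') (H : seq (form L V')) :
    map (rename (omap g)) (map (rename Some) H) =
    map (rename Some) (map (rename g) H).
  by rewrite -!map_comp; apply: eq_map => B /=; rewrite !rename_comp.
move=> GA; elim: {V G A} GA W f => [V G A TA|V G A AG|V G A B _ IH|
   V G A B _ IH1 _ IH2|V G A _ IH|V G A _ IH|V G A t _ IH|V G t|
   V G A s t _ IH1 _ IH2|V G A _ IH] W f /=.
- by rewrite rename_comp (eq_from_void (f \o _) (of_void W)); apply: nd_axiom.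
- exact/nd_hyp/List.in_map.
- exact/nd_imp_intro/IH.
- exact: nd_imp_elim (IH1 _ _) (IH2 _ _).
- exact/nd_raa/IH.
- by apply: nd_all_intro; have := IH _ (omap f); rewrite shift.
- by rewrite rename_inst; apply: nd_all_elim; apply: IH.
- exact: nd_eq_refl.
- rewrite rename_inst; apply: nd_eq_elim (IH1 _ _) _.
  by rewrite -rename_inst; apply: IH2.
- apply: nd_inhabited; have := IH _ (omap f); rewrite shift.
  by rewrite !rename_comp.
Qed.

Lemma nd_weaken (L : signature) (T : theory L) (V : Type)
    (G H : seq (form L V)) A :
  nd T G A -> (forall B, List.In B G -> List.In B H) -> nd T H A.
Proof.
move=> GA; elim: {V G A} GA H => [V G A TA|V G A AG|V G A B _ IH|
   V G A B _ IH1 _ IH2|V G A _ IH|V G A _ IH|V G A t _ IH|V G t|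
   V G A s t _ IH1 _ IH2|V G A _ IH] H GH.
- exact: nd_axiom.
- exact/nd_hyp/GH.
- by apply/nd_imp_intro/IH => C /= [->|/GH]; [left|right].
- exact: nd_imp_elim (IH1 _ GH) (IH2 _ GH).
- by apply/nd_raa/IH => C /= [->|/GH]; [left|right].
- apply/nd_all_intro/IH => C /List.in_map_iff[B [<- /GH BH]].
  exact: List.in_map.
- exact/nd_all_elim/IH.
- exact: nd_eq_refl.
- exact: nd_eq_elim (IH1 _ GH) (IH2 _ GH).
- apply/nd_inhabited/IH => C /List.in_map_iff[B [<- /GH BH]].
  exact: List.in_map.
Qed.

(** * Structures and soundness *)

Record structure (L : signature) := Structure {
  carrier : Type;
  some_point : carrier;
  ifun : forall f : funs L, ('I_(far f) -> carrier) -> carrier;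
  irel : forall r : rels L, ('I_(rar r) -> carrier) -> Prop
}.

Section Satisfaction.
Context {L : signature} (M : structure L).

Fixpoint teval (V : Type) (t : term L V) (rho : V -> carrier M) : carrier M :=
  match t with
  | Var v => rho v
  | App f ts => ifun (fun i => teval (ts i) rho)
  end.

Fixpoint sat (V : Type) (A : form L V) : (V -> carrier M) -> Prop :=
  match A with
  | Bot => fun=> False
  | Eq s t => fun rho => teval s rho = teval t rho
  | Rel r ts => fun rho => irel (fun i => teval (ts i) rho)
  | Imp A B => fun rho => sat A rho -> sat B rho
  | All A => fun rho => forall d, sat A (oapp rho d)
  end.

Definition holds (A : sentence L) : Prop := sat A (of_void _).
Definition models (T : theory L) : Prop := forall A, T A -> holds A.

Lemma teval_rename (V W : Type) (f : V -> W) (t : term L V) rho :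
  teval (rename_term f t) rho = teval t (rho \o f).
Proof.
elim: t => [//|h ts IH] /=; congr ifun.
by apply: functional_extensionality => i; apply: IH.
Qed.

Lemma sat_rename (V W : Type) (f : V -> W) (A : form L V) rho :
  sat (rename f A) rho <-> sat A (rho \o f).
Proof.
elim: A W f rho => {V} [//|V u t|V r ts|V A IHA B IHB|V A IHA] W f rho /=.
- by rewrite !teval_rename.
- rewrite (_ : (fun i => _) = fun i => teval (ts i) (rho \o f)) //.
  by apply: functional_extensionality => i; rewrite teval_rename.
- by rewrite IHA IHB.
- have E d : oapp rho d \o omap f = oapp (rho \o f) d.
    by apply: functional_extensionality; case.
  by split=> H d; have := H d; rewrite IHA E.
Qed.

Lemma teval_subst (V W : Type) (s : V -> term L W) (t : term L V) rho :
  teval (subst_term s t) rho = teval t (fun v => teval (s v) rho).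
Proof.
elim: t => [//|h ts IH] /=; congr ifun.
by apply: functional_extensionality => i; apply: IH.
Qed.

Lemma sat_subst (V W : Type) (s : V -> term L W) (A : form L V) rho :
  sat (subst s A) rho <-> sat A (fun v => teval (s v) rho).
Proof.
elim: A W s rho => {V} [//|V u t|V r ts|V A IHA B IHB|V A IHA] W s rho /=.
- by rewrite !teval_subst.
- rewrite (_ : (fun i => _) =
               fun i => teval (ts i) (fun v => teval (s v) rho)) //.
  by apply: functional_extensionality => i; rewrite teval_subst.
- by rewrite IHA IHB.
- have E d : (fun v => teval (up s v) (oapp rho d)) =
             oapp (fun v => teval (s v) rho) d.
    by apply: functional_extensionality; case=> [v|//] /=; rewrite teval_rename.
  by split=> H d; have := H d; rewrite IHA E.
Qed.

Lemma sat_inst (V : Type) (A : form L (option V)) t rho :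
  sat (inst A t) rho <-> sat A (oapp rho (teval t rho)).
Proof.
rewrite sat_subst.
rewrite (_ : (fun v => _) = oapp rho (teval t rho)) //.
by apply: functional_extensionality; case.
Qed.

Lemma sat_sentence (A : sentence L) rho : sat A rho <-> holds A.
Proof. by rewrite /holds (eq_from_void rho (of_void _)). Qed.

Lemma nd_sound (T : theory L) (V : Type) (G : seq (form L V)) A :
  models T -> nd T G A ->
  forall rho, (forall B, List.In B G -> sat B rho) -> sat A rho.
Proof.
move=> MT GA.
have shift V' (H : seq (form L V')) rho d :
    (forall B, List.In B H -> sat B rho) ->
    forall B, List.In B (map (rename Some) H) -> sat B (oapp rho d).
  by move=> MH B /List.in_map_iff[C [<- /MH]]; rewrite sat_rename.
elim: {V G A} GA => [V G A TA|V G A AG|V G A B _ IH|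
   V G A B _ IH1 _ IH2|V G A _ IH|V G A _ IH|V G A t _ IH|V G t|
   V G A s t _ IH1 _ IH2|V G A _ IH] rho MG.
- by rewrite sat_rename sat_sentence; apply: MT.
- exact: MG.
- by move=> MA; apply: IH => C /= [<-|/MG].
- by apply: (IH1 _ MG); apply: IH2.
- by apply: NNPP => nA; apply: (IH rho) => C /= [<-|/MG].
- by move=> d; apply/IH/shift.
- by rewrite sat_inst; apply: IH.
- by [].
- by rewrite sat_inst -(IH1 _ MG) -sat_inst; apply: IH2.
- have := IH (oapp rho (some_point M)); rewrite sat_rename; apply.
  exact: shift.
Qed.

Lemma sound (T : theory L) A : models T -> proves T A -> holds A.
Proof. by move=> MT TA; apply: (nd_sound MT TA) => B []. Qed.

End Satisfaction.

(** * Completeness *)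

Lemma functional_choice (A B : Type) (R : A -> B -> Prop) :
  (forall x, exists y, R x y) -> exists f, forall x, R x (f x).
Proof.
move=> H; exists (fun x => proj1_sig (constructive_indefinite_description _ (H x))).
by move=> x; case: constructive_indefinite_description.
Qed.

(** The points of [Q] are the classes themselves, as predicates [R x]; extensionality and proof
    irrelevance identify equal classes. The Euclidean law is the form that replacing equals by
    equals gives directly, and with reflexivity it contains symmetry and transitivity. *)
Lemma quotient_exists (X : Type) (R : X -> X -> Prop) :
  (forall x, R x x) -> (forall x y z, R x y -> R x z -> R y z) ->
  exists (Q : Type) (p : X -> Q),
    (forall q, exists x, p x = q) /\ (forall x y, p x = p y <-> R x y).
Proof.
move=> Rxx Reuc; exists {P : X -> Prop | exists x, P = R x}.
exists (fun x => exist _ (R x) (ex_intro _ x erefl)); split.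
  by case=> P [x Px]; subst P; exists x.
move=> x y; split=> [[E]|Rxy].
  by rewrite E.
apply: eq_exist_uncurried.
suff E : R x = R y by exists E; apply: proof_irrelevance.
apply: functional_extensionality => z; apply: propositional_extensionality.
split=> [Rxz|Ryz]; first exact: Reuc Rxy Rxz.
exact: Reuc (Reuc _ _ _ Rxy (Rxx x)) Ryz.
Qed.

(** * Free variables and the existence of fresh ones *)

Section FreeVariables.
Context {L : signature}.

Fixpoint occurs_term (V : Type) (v : V) (t : term L V) : Prop :=
  match t with
  | Var w => v = w
  | App f ts => exists i, occurs_term v (ts i)
  end.

Fixpoint occurs (V : Type) (A : form L V) : V -> Prop :=
  match A with
  | Bot => fun=> False
  | Eq s t => fun v => occurs_term v s \/ occurs_term v t
  | Rel r ts => fun v => exists i, occurs_term v (ts i)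
  | Imp A B => fun v => occurs A v \/ occurs B v
  | All A => fun v => occurs A (Some v)
  end.

Lemma eq_rename_term (V W : Type) (f g : V -> W) (t : term L V) :
  (forall v, occurs_term v t -> f v = g v) -> rename_term f t = rename_term g t.
Proof.
elim: t => [v|h ts IH] /= fg; first by rewrite fg.
congr App; apply: functional_extensionality => i; apply: IH => v vi.
by apply: fg; exists i.
Qed.

Lemma eq_rename (V W : Type) (f g : V -> W) (A : form L V) :
  (forall v, occurs A v -> f v = g v) -> rename f A = rename g A.
Proof.
elim: A W f g => {V} [//|V u t|V r ts|V A IHA B IHB|V A IHA] W f g /= fg.
- by congr Eq; apply: eq_rename_term => v vt; apply: fg; [left|right].
- congr Rel; apply: functional_extensionality => i.
  by apply: eq_rename_term => v vi; apply: fg; exists i.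
- by congr Imp; [apply: IHA|apply: IHB] => v vA; apply: fg; [left|right].
- by congr All; apply: IHA => -[v /fg /= ->|].
Qed.

Lemma ord_bound n (P : 'I_n -> nat -> Prop) :
  (forall i, exists b, forall x, P i x -> x < b) ->
  exists b, forall i x, P i x -> x < b.
Proof.
move=> /functional_choice[b Pb]; exists (\max_i b i) => i x /Pb xb.
exact: leq_trans xb (leq_bigmax i).
Qed.

Lemma occurs_term_bound (V : Type) (e : V -> nat) (t : term L V) :
  exists b, forall x, (exists2 v, occurs_term v t & e v = x) -> x < b.
Proof.
elim: t => [v|h ts /ord_bound[b tsb]]; first by exists (e v).+1 => _ [_ -> <-] /=.
by exists b => x [v [i vi] vx]; apply: (tsb i); exists v.
Qed.

Lemma occurs_bound (V : Type) (e : V -> nat) (A : form L V) :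
  exists b, forall v, occurs A v -> e v < b.
Proof.
elim: A e => {V} [|V u t|V r ts|V A IHA B IHB|V A IHA] e /=.
- by exists 0.
- have [[b ub] [c tc]] := (occurs_term_bound e u, occurs_term_bound e t).
  exists (maxn b c) => v [vu|vt]; rewrite leq_max; apply/orP.
    by left; apply: ub; exists v.
  by right; apply: tc; exists v.
- have [|b tsb] := @ord_bound _ (fun i x => exists2 v, occurs_term v (ts i) & e v = x).
    by move=> i; apply: occurs_term_bound.
  by exists b => v [i vi]; apply: (tsb i); exists v.
- have [[b Ab] [c Bc]] := (IHA e, IHB e).
  by exists (maxn b c) => v [/Ab|/Bc] vb; rewrite leq_max vb ?orbT.
(* The bound variable gets the dummy number 0; only the variables [Some v] are counted
   afterwards. *)
- by have [b Ab] := IHA (oapp e 0); exists b => v /Ab.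
Qed.

Lemma fresh_exists (G : seq (form L nat)) :
  exists b, forall A, List.In A G -> ~ occurs A b.
Proof.
suff [b Gb] : exists b, forall A, List.In A G -> forall v, occurs A v -> v < b.
  by exists b => A AG /(Gb _ AG); rewrite ltnn.
elim: G => [|A G [c Gc]]; first by exists 0.
have [b Ab] := occurs_bound id A.
exists (maxn b c) => B [<- v /Ab /= vb|/Gc Bc v /Bc vc]; rewrite leq_max ?vb //.
by rewrite vc orbT.
Qed.

End FreeVariables.

(** * Henkin extension of a consistent finite context *)

Section Henkin.
Context {L : signature} (T : theory L).

Local Notation "G |- A" := (nd T G A) (at level 70).

Lemma nd_exfalso V (G : seq (form L V)) A : G |- Bot -> G |- A.
Proof. by move=> GB; apply: nd_raa; apply: nd_weaken GB _ => B; right. Qed.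

(** The renaming [f] makes [b] the bound variable and shifts all others. As [b] occurs neither in
    [G] nor in [All C], it acts on [G] as plain weakening and turns the instance at [b] back into
    [C]. *)
Lemma nd_fresh (G : seq (form L nat)) C b :
  (forall A, List.In A (All C :: G) -> ~ occurs A b) ->
  G |- inst C (Var b) -> G |- All C.
Proof.
move=> Gb GC; pose f v := if v == b then None else Some v.
have fE A : ~ occurs A b -> rename f A = rename Some A.
  by move=> nAb; apply: eq_rename => v vA; rewrite /f; case: eqP => // vb; subst v.
apply: nd_all_intro; have := rename_nd f GC.
rewrite (_ : map (rename f) G = map (rename Some) G); last first.
  apply/List.map_ext_in => A AG; apply: fE; apply: Gb; by right.
suff -> : rename f (inst C (Var b)) = rename id C by rewrite rename_id.
rewrite rename_inst /inst subst_rename.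
set s := _ \o _; rewrite (_ : s = Var \o obind f); last first.
  apply: functional_extensionality; case=> [v|]; rewrite /s /= /f; last by rewrite eqxx.
  by case: eqP.
rewrite subst_Var; apply: eq_rename => -[v|//] vC /=; rewrite /f.
by case: eqP => // vb; subst v; case: (Gb (All C)) => //; left.
Qed.

Definition consistent (G : seq (form L nat)) : Prop := ~ G |- Bot.

Definition number (B : form L nat) : nat := pickle (code_form id B).

Lemma number_inj : injective number.
Proof. by move=> A B /(pcan_inj pickleK) /code_form_inj; apply. Qed.

(** Stage [n] of the construction. Since [number] is injective, at most one formula is treated
    there; a negated universal formula enters together with a counterexample. *)
Definition extends_at (n : nat) (G H : seq (form L nat)) : Prop :=
  (forall A, List.In A G -> List.In A H) /\
  forall B, number B = n -> consistent (B :: G) ->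
    List.In B H /\
    forall C, B = Neg (All C) -> exists t, List.In (Neg (inst C t)) H.

Lemma henkin_step n G :
  consistent G -> exists2 H, consistent H & extends_at n G H.
Proof.
move=> Gcon.
case: (classic (exists2 B, number B = n & consistent (B :: G))); last first.
  by move=> noB; exists G => //; split=> // B Bn Bcon; case: noB; exists B.
move=> [B Bn Bcon].
case: (classic (exists C, B = Neg (All C))) => [[C BC]|noC]; last first.
  exists (B :: G) => //; split=> [A|B' B'n _]; first by right.
  have -> : B' = B by apply: number_inj; rewrite Bn.
  by split=> [|C BC]; [left|case: noC; exists C].
(* A variable serves as Henkin witness: every stage is a finite list, so a fresh one exists and no
   constants need be added. If the counterexample at [b] were inconsistent, generalizing over [b]
   would give [All C], against [B]. *)
have [b Gb] := fresh_exists (B :: G).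
exists [:: Neg (inst C (Var b)), B & G].
  move=> incon; apply: Bcon.
  have BAC : (B :: G) |- All C.
    apply: (@nd_fresh _ _ b); last exact: nd_raa.
    move=> A /= [<-|AG]; last exact: Gb.
    by move=> bC; apply: (Gb B); [left|rewrite BC; left].
  apply: (nd_imp_elim _ BAC); rewrite -[Imp _ _]BC; apply: nd_hyp; by left.
split=> [A|B' B'n _]; first by right; right.
have -> : B' = B by apply: number_inj; rewrite Bn.
split=> [|C']; first by right; left.
by rewrite BC => -[<-]; exists (Var b); left.
Qed.

Variables (G0 : seq (form L nat)) (G0con : consistent G0).

Lemma henkin_chain : exists st : nat -> seq (form L nat),
  [/\ st 0 = G0, forall n, consistent (st n)
    & forall n, extends_at n (st n) (st n.+1)].
Proof.
have [f fP] : exists f : nat * {G | consistent G} -> {G | consistent G},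
    forall x, extends_at x.1 (sval x.2) (sval (f x)).
  apply: (functional_choice (R := fun x y => extends_at x.1 (sval x.2) (sval y))).
  move=> [n [G Gcon]].
  by have [H Hcon GH] := henkin_step n Gcon; exists (exist _ H Hcon).
pose st := fix st n : {G | consistent G} :=
  if n is n'.+1 then f (n', st n') else exist _ G0 G0con.
exists (fun n => sval (st n)); split=> //; first by move=> n; apply: svalP.
by move=> n; apply: (fP (n, st n)).
Qed.

(** [D] is the union of the stages. A derivation uses finitely many hypotheses, hence already lives
    at one stage; and [A] is settled at stage [number A], where it is either added or refuted. *)
Lemma henkin_set : exists D : form L nat -> Prop,
  [/\ forall A, List.In A G0 -> D A,
      forall G A, (forall B, List.In B G -> D B) -> G |- A -> D A,
      ~ D Bot, forall A, D A \/ D (Neg A)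
    & forall C, D (Neg (All C)) -> exists t, D (Neg (inst C t))].
Proof.
have [st [st0 stcon stP]] := henkin_chain.
have mono n m A : n <= m -> List.In A (st n) -> List.In A (st m).
  by move=> /subnK <-; elim: (m - n) => // d IH /IH /(proj1 (stP _) _).
have fin G : (forall B, List.In B G -> exists n, List.In B (st n)) ->
    exists n, forall B, List.In B G -> List.In B (st n).
  elim: G => [|A G IH] GD; first by exists 0.
  have [|n Gn] := IH; first by move=> B BG; apply: GD; right.
  have [|m Am] := GD A; first by left.
  exists (maxn n m) => B [<-|/Gn Bn]; first exact: mono (leq_maxr _ _) Am.
  exact: mono (leq_maxl _ _) Bn.
have decide A : (exists n, List.In A (st n)) \/ exists n, st n |- Neg A.
  case: (classic (consistent (A :: st (number A)))) => [Acon|Aincon].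
    by left; exists (number A).+1; apply: (proj2 (stP _) A erefl Acon).1.
  by right; exists (number A); apply: nd_imp_intro; apply: NNPP.
have closed n A : st n |- A -> exists m, List.In A (st m).
  move=> nA; case: (decide A) => // -[m mA]; case: (stcon (maxn n m)).
  have up_to k B : k <= maxn n m -> st k |- B -> st (maxn n m) |- B.
    by move=> kn kB; apply: nd_weaken kB _ => C; apply: mono.
  by apply: nd_imp_elim (up_to _ _ (leq_maxr _ _) mA) (up_to _ _ (leq_maxl _ _) nA).
exists (fun A => exists n, List.In A (st n)); split.
- by move=> A AG; exists 0; rewrite st0.
- move=> G A /fin[n Gn] GA; apply: (closed n); exact: nd_weaken GA Gn.
- by move=> [n nB]; apply: (stcon n); apply: nd_hyp.
- by move=> A; case: (decide A) => [|[n /closed]]; [left|right].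
- move=> C [n nC]; pose B := Neg (All C).
  case: (classic (consistent (B :: st (number B)))) => [Bcon|Bincon].
    have [t Ct] := (proj2 (stP _) B erefl Bcon).2 C erefl.
    by exists t, (number B).+1.
  have [m mC] : exists m, List.In (Neg B) (st m).
    by apply: (closed (number B)); apply: nd_imp_intro; apply: NNPP.
  case: (stcon (maxn n m)); apply: (@nd_imp_elim _ _ _ _ B); apply: nd_hyp.
    exact: mono (leq_maxr _ _) mC.
  exact: mono (leq_maxl _ _) nC.
Qed.

End Henkin.

(** Replacement of equals in [nd] acts on one term at a time, so a whole tuple of arguments is
    exchanged position by position; [k] counts the positions already exchanged. *)
Lemma finfun_replace (n : nat) (X : Type) (R : X -> X -> Prop)
    (P : ('I_n -> X) -> Prop) :
  (forall (s : 'I_n -> X) j x y, R x y ->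
     P (fun i => if i == j then x else s i) ->
     P (fun i => if i == j then y else s i)) ->
  forall s s', (forall i, R (s i) (s' i)) -> P s -> P s'.
Proof.
move=> step s s' ss' Ps.
suff H k : P (fun i : 'I_n => if i < k then s' i else s i).
  have := H n; rewrite (_ : (fun i => _) = s') //.
  by apply: functional_extensionality => i; rewrite ltn_ord.
elim: k => [//|k IH]; case: (ltnP k n) => [kn|nk]; last first.
  rewrite (_ : (fun i => _) = fun i : 'I_n => if i < k then s' i else s i) //.
  apply: functional_extensionality => i.
  by rewrite ltnS ltnW ?(leq_trans (ltn_ord i)).
pose j := Ordinal kn; pose u (i : 'I_n) := if i < k then s' i else s i.
have E1 : u = fun i => if i == j then s j else u i.
  apply: functional_extensionality => i; case: eqP => // ->.
  by rewrite /u ltnn.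
have E2 : (fun i : 'I_n => if i < k.+1 then s' i else s i) =
          fun i => if i == j then s' j else u i.
  apply: functional_extensionality => i; rewrite ltnS leq_eqVlt /u.
  by rewrite -[_ == k]/(i == j); case: eqP => [->|].
by rewrite E2; apply: step (ss' j) _; rewrite -E1.
Qed.

(** * The term model of a Henkin set *)

Section TermModel.
Context {L : signature} (T : theory L) (D : form L nat -> Prop).
Hypothesis D_nd :
  forall G A, (forall B, List.In B G -> D B) -> nd T G A -> D A.
Hypothesis D_Bot : ~ D Bot.
Hypothesis D_total : forall A, D A \/ D (Neg A).
Hypothesis D_All : forall C, D (Neg (All C)) -> exists t, D (Neg (inst C t)).

Lemma D_Imp A B : D (Imp A B) <-> (D A -> D B).
Proof.
split=> [DAB DA|DAB].
  apply: (@D_nd [:: Imp A B; A]) => [C /= [<-|[<-|]] //|].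
  by apply: (@nd_imp_elim _ _ _ _ A); apply: nd_hyp; [left|right; left].
case: (D_total A) => [/DAB DB|DnA].
  by apply: (@D_nd [:: B]) => [C /= [<-|] //|]; apply/nd_imp_intro/nd_hyp; right; left.
apply: (@D_nd [:: Neg A]) => [C /= [<-|] //|]; apply/nd_imp_intro/nd_exfalso.
by apply: (@nd_imp_elim _ _ _ _ A); apply: nd_hyp; [right; left|left].
Qed.

Lemma D_AllE C : D (All C) <-> forall t, D (inst C t).
Proof.
split=> [DC t|DC].
  apply: (@D_nd [:: All C]) => [B /= [<-|] //|].
  by apply: nd_all_elim; apply: nd_hyp; left.
case: (D_total (All C)) => // /D_All[t] /D_Imp /(_ (DC t)) /D_Bot [].
Qed.

Lemma D_refl t : D (Eq t t).
Proof. by apply: (@D_nd [::]) => // ; apply: nd_eq_refl. Qed.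

Lemma D_eq_elim A s t : D (Eq s t) -> D (inst A s) -> D (inst A t).
Proof.
move=> Dst DA; apply: (@D_nd [:: Eq s t; inst A s]) => [B /= [<-|[<-|]] //|].
by apply: (@nd_eq_elim _ _ _ _ _ s); apply: nd_hyp; [left|right; left].
Qed.

Lemma inst_lift (n : nat) (s : 'I_n -> term L nat) j t :
  (fun i => subst_term (fun v => if v is Some v' then Var v' else t)
     (if i == j then Var None else rename_term Some (s i))) =
  fun i => if i == j then t else s i.
Proof.
apply: functional_extensionality => i; case: eqP => // _.
by rewrite subst_rename_term subst_term_Var.
Qed.

Lemma inst_lift_term (s t : term L nat) :
  subst_term (fun v => if v is Some v' then Var v' else t)
    (rename_term Some s) = s.
Proof. by rewrite subst_rename_term subst_term_Var. Qed.

Lemma D_euclid s t u : D (Eq s t) -> D (Eq s u) -> D (Eq t u).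
Proof.
move=> Dst Dsu.
have := @D_eq_elim (Eq (Var None) (rename_term Some u)) s t Dst.
by rewrite /inst /= !inst_lift_term; apply.
Qed.

Lemma D_Rel r ts ts' : (forall i, D (Eq (ts i) (ts' i))) ->
  D (Rel r ts) -> D (Rel r ts').
Proof.
move: ts ts'; apply: (finfun_replace (R := fun s t => D (Eq s t))
                        (P := fun us => D (Rel r us))) => s j t u Dtu.
have := @D_eq_elim (Rel r (fun i =>
  if i == j then Var None else rename_term Some (s i))) t u Dtu.
by rewrite /inst /= !inst_lift; apply.
Qed.

Lemma D_App f ts ts' : (forall i, D (Eq (ts i) (ts' i))) ->
  D (Eq (App f ts) (App f ts')).
Proof.
move=> tsts'.
apply: (finfun_replace (R := fun s t => D (Eq s t))
          (P := fun us => D (Eq (App f ts) (App f us))) _ tsts'); last exact: D_refl.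
move=> s j t u Dtu.
have := @D_eq_elim (Eq (rename_term Some (App f ts)) (App f (fun i =>
  if i == j then Var None else rename_term Some (s i)))) t u Dtu.
rewrite /inst /= !inst_lift.
have tsE v : (fun i => subst_term (fun w : option nat =>
    if w is Some w' then Var w' else v) (rename_term Some (ts i))) = ts.
  by apply: functional_extensionality => i; rewrite inst_lift_term.
by rewrite !tsE; apply.
Qed.

Lemma term_model : exists (M : structure L) (p : term L nat -> carrier M),
  forall V (A : form L V) (s : V -> term L nat),
    sat A (p \o s) <-> D (subst s A).
Proof.
have [Q [p [p_onto pE]]] := quotient_exists D_refl D_euclid.
have [c cK] := functional_choice p_onto.
(* [c] selects a term in each class; [D_App] and [D_Rel] make the choice immaterial. [Var 0] merely
   provides some point. *)
pose M := Structure (p (Var 0)) (fun f qs => p (App f (fun i => c (qs i))))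
            (fun r qs => D (Rel r (fun i => c (qs i)))).
have cp t : D (Eq (c (p t)) t) by apply/pE.
have pc t : D (Eq t (c (p t))) by apply/pE.
exists M, p.
have tP V (t : term L V) s : teval (M := M) t (p \o s) = p (subst_term s t).
  elim: t => [//|f ts IH] /=; apply/pE; apply: D_App => i; apply/pE.
  by rewrite IH cK.
move=> V A; elim: A => {V} [V|V t u|V r ts|V A IHA B IHB|V A IHA] s /=.
- by split=> // /D_Bot.
- by rewrite !tP; apply: pE.
- by split; apply: D_Rel => i; rewrite tP.
- by rewrite D_Imp IHA IHB.
- rewrite D_AllE; split=> H t.
    by rewrite inst_subst_up -IHA; have := H (p t); congr sat;
       apply: functional_extensionality; case.
  have [t' <-] := p_onto t; have := H t'; rewrite inst_subst_up -IHA.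
  by congr sat; apply: functional_extensionality; case.
Qed.

End TermModel.

Theorem complete (L : signature) (T : theory L) (A : sentence L) :
  (forall M : structure L, models M T -> holds M A) -> proves T A.
Proof.
move=> TA; apply: NNPP => nA.
pose A' := rename (of_void nat) A.
have con : consistent T [:: Neg A'].
  (* A refutation may use free variables although [A] has none. They are merged into one variable,
     which [nd_inhabited] then removes. *)
  move=> /nd_raa /(rename_nd (fun=> None : option void)) /= A0.
  apply: nA; apply: nd_inhabited; move: A0.
  by rewrite rename_comp; congr nd; congr rename; apply: eq_from_void.
have [D [D0 D_nd D_Bot D_tot D_All]] := henkin_set con.
have [M [p MP]] := term_model D_nd D_Bot D_tot D_All.
have holdsE B : holds M B <-> D (rename (of_void nat) B).
  by rewrite -subst_Var -MP sat_sentence.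
have : holds M A.
  apply: TA => B TB; apply/holdsE; apply: (D_nd [::]) => //; exact: nd_axiom.
rewrite holdsE => DA; apply: D_Bot.
apply: (D_nd [:: Neg A'; A']) => [B /= [<-|[<-|//]] //|].
  by apply: D0; left.
by apply: (@nd_imp_elim _ _ _ _ A'); apply: nd_hyp; [left|right; left].
Qed.

(** * Evaluations *)

Definition copair (A B X : Type) (f : A -> X) (g : B -> X) (x : A + B) : X :=
  match x with inl a => f a | inr b => g b end.

(* Covers both satisfaction in a structure and the satisfaction of translated
   formulas, in which the quantifiers range over tuples in [dom]. *)
Record evaluation (L : signature) (X : Type) (dom : X -> Prop)
    (S : forall V, form L V -> (V -> X) -> Prop) : Prop := Evaluation {
  ev_Bot : forall V (rho : V -> X), S V Bot rho <-> False;
  ev_Imp : forall V (A B : form L V) rho,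
    S V (Imp A B) rho <-> (S V A rho -> S V B rho);
  ev_All : forall V (A : form L (option V)) rho,
    S V (All A) rho <-> forall x, dom x -> S _ A (oapp rho x);
  ev_rename : forall V W (f : V -> W) (A : form L V) rho,
    S W (rename f A) rho <-> S V A (rho \o f)
}.

Section Evaluation.
Context {L : signature} {X : Type} {dom : X -> Prop}.
Context {S : forall V, form L V -> (V -> X) -> Prop} (ev : evaluation dom S).
Arguments S {V}.

Lemma ev_Neg V (A : form L V) rho : S (Neg A) rho <-> ~ S A rho.
Proof. by rewrite /Neg (ev_Imp ev) (ev_Bot ev). Qed.

Lemma ev_Top V (rho : V -> X) : S Top rho.
Proof. by rewrite /Top (ev_Imp ev). Qed.

Lemma ev_And V (A B : form L V) rho : S (And A B) rho <-> S A rho /\ S B rho.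
Proof.
rewrite /And ev_Neg (ev_Imp ev) ev_Neg.
by case: (classic (S A rho)); case: (classic (S B rho)); tauto.
Qed.

Lemma ev_Or V (A B : form L V) rho : S (Or A B) rho <-> S A rho \/ S B rho.
Proof.
by rewrite /Or (ev_Imp ev) ev_Neg; case: (classic (S A rho)); tauto.
Qed.

Lemma ev_Iff V (A B : form L V) rho :
  S (Iff A B) rho <-> (S A rho <-> S B rho).
Proof. by rewrite /Iff ev_And !(ev_Imp ev). Qed.

Lemma ev_Ex V (A : form L (option V)) rho :
  S (Ex A) rho <-> exists2 x, dom x & S A (oapp rho x).
Proof.
rewrite /Ex ev_Neg (ev_All ev); split=> [nA|[x dx Ax] nA].
  apply: NNPP => nE; apply: nA => x dx; rewrite ev_Neg => Ax.
  by apply: nE; exists x.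
by have := nA x dx; rewrite ev_Neg.
Qed.

Lemma ev_AndN V n (F : 'I_n -> form L V) rho :
  S (AndN F) rho <-> forall i, S (F i) rho.
Proof.
rewrite /AndN; suff -> : forall s, S (foldr And Top [seq F i | i <- s]) rho <->
    forall i, i \in s -> S (F i) rho.
  by split=> H i *; apply: H; rewrite ?mem_enum.
elim=> [|j s IH] /=; first by split=> // _; apply: ev_Top.
rewrite ev_And IH; split=> [[Fj Fs] i|Fs].
  by rewrite inE => /orP[/eqP ->|/Fs].
by split=> [|i is_]; apply: Fs; rewrite inE ?eqxx ?is_ ?orbT.
Qed.

Lemma ev_OrN V n (F : 'I_n -> form L V) rho :
  S (OrN F) rho <-> exists i, S (F i) rho.
Proof.
rewrite /OrN; suff -> : forall s, S (foldr Or Bot [seq F i | i <- s]) rho <->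
    exists2 i, i \in s & S (F i) rho.
  by split=> [[i _]|[i]] Fi; exists i; rewrite ?mem_enum.
elim=> [|j s IH] /=; first by rewrite (ev_Bot ev); split=> // -[].
rewrite ev_Or IH; split=> [[Fj|[i is_ Fi]]|[i]].
- by exists j; rewrite ?mem_head.
- by exists i; rewrite ?inE ?is_ ?orbT.
- by rewrite inE => /orP[/eqP ->|is_ Fi]; [left|right; exists i].
Qed.

(** The index [ord0] is bound innermost, so the induction hypothesis first fixes the values at the
    other indices, which are reached through [lift ord0]. *)
Lemma ev_all_ord n V (A : form L (V + 'I_n)) rho :
  S (all_ord A) rho <->
  forall g : 'I_n -> X, (forall i, dom (g i)) -> S A (copair rho g).
Proof.
elim: n V A rho => [|n IH] V A rho /=.
  rewrite (ev_rename ev).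
  have E g : copair rho g = rho \o
      (fun x : V + 'I_0 => match x with inl v => v | inr i => ord0_elim V i end).
    by apply: functional_extensionality; case=> [//|[]].
  split=> [H g _|H]; first by rewrite E.
  by rewrite -(E (fun i => ord0_elim X i)); apply: H; case.
rewrite IH.
have E (g : 'I_n.+1 -> X) : oapp (copair rho (g \o lift ord0)) (g ord0) \o
    (fun x : V + 'I_n.+1 => match x with
         | inl v => Some (inl v) | inr i => omap inr (unlift ord0 i) end) =
    copair rho g.
  apply: functional_extensionality; case=> [//|i] /=.
  by case: unliftP => [j|] ->.
split=> [H g dg|H g dg].
  have := H (g \o lift ord0) (fun i => dg _).
  by rewrite (ev_All ev) => /(_ _ (dg ord0)); rewrite (ev_rename ev) E.
rewrite (ev_All ev) => x dx; rewrite (ev_rename ev).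
pose g' i := oapp g x (unlift ord0 i).
have -> : g = g' \o lift ord0.
  by apply: functional_extensionality => i; rewrite /g' /= liftK.
rewrite -[x](_ : g' ord0 = x) ?E; last by rewrite /g' unlift_none.
by apply: H => i; rewrite /g'; case: unlift => /=.
Qed.

Lemma ev_all_block (I : finType) V (A : form L (V + I)) rho :
  S (all_block A) rho <->
  forall g : I -> X, (forall i, dom (g i)) -> S A (copair rho g).
Proof.
rewrite ev_all_ord.
split=> H g dg.
  have := H (g \o enum_val) (fun i => dg _); rewrite (ev_rename ev).
  congr S; apply: functional_extensionality; case=> //= i.
  by rewrite enum_rankK.
rewrite (ev_rename ev); have := H (g \o enum_rank) (fun i => dg _).
by congr S; apply: functional_extensionality; case.
Qed.

Lemma ev_ex_block (I : finType) V (A : form L (V + I)) rho :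
  S (ex_block A) rho <->
  exists2 g : I -> X, (forall i, dom (g i)) & S A (copair rho g).
Proof.
rewrite /ex_block ev_Neg ev_all_block; split=> [nA|[g dg Ag] nA].
  apply: NNPP => nE; apply: nA => g dg; rewrite ev_Neg => Ag.
  by apply: nE; exists g.
by have := nA g dg; rewrite ev_Neg.
Qed.

End Evaluation.

Section SatConnectives.
Context {L : signature} (M : structure L).

Lemma sat_evaluation : evaluation (fun=> True) (@sat L M).
Proof.
split=> //=; last by move=> V W f A rho; apply: sat_rename.
by move=> V A rho; split=> H d; have := H d; [|apply].
Qed.

Definition sat_Neg := @ev_Neg _ _ _ _ sat_evaluation.
Definition sat_And := @ev_And _ _ _ _ sat_evaluation.
Definition sat_Iff := @ev_Iff _ _ _ _ sat_evaluation.
Definition sat_AndN := @ev_AndN _ _ _ _ sat_evaluation.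
Definition sat_OrN := @ev_OrN _ _ _ _ sat_evaluation.

Lemma sat_All V (A : form L (option V)) (rho : V -> carrier M) :
  sat (All A) rho <-> forall d, sat A (oapp rho d).
Proof. by []. Qed.

Lemma sat_Ex V (A : form L (option V)) (rho : V -> carrier M) :
  sat (Ex A) rho <-> exists d, sat A (oapp rho d).
Proof. by rewrite (ev_Ex sat_evaluation); split=> [[d _]|[d]]; exists d. Qed.

Lemma sat_all_block (I : finType) V (A : form L (V + I)) rho :
  sat (all_block A) rho <-> forall g : I -> carrier M, sat A (copair rho g).
Proof.
by rewrite (ev_all_block sat_evaluation); split=> H g *; apply: H.
Qed.

Lemma sat_ex_block (I : finType) V (A : form L (V + I)) rho :
  sat (ex_block A) rho <-> exists g : I -> carrier M, sat A (copair rho g).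
Proof.
by rewrite (ev_ex_block sat_evaluation); split=> [[g _]|[g]]; exists g.
Qed.

Lemma sat_tuple_eq k V (x y : 'I_k -> V) (rho : V -> carrier M) :
  sat (tuple_eq x y) rho <-> rho \o x = rho \o y.
Proof.
rewrite sat_AndN; split=> [H|H i].
  by apply: functional_extensionality => i; apply: H.
exact: (congr1 (fun f => f i) H).
Qed.

End SatConnectives.

(** * Translations *)

Section TranslationSemantics.
Context {k : nat} {L L' : signature} (K : translation k L L').
Context (M : structure L').

Local Notation point := ('I_k -> carrier M).

Definition tdom (x : point) : Prop := sat (tr_dom K) x.

Definition teq (x y : point) : Prop :=
  sat (tr_eq K) (fun p => if p.1 then y p.2 else x p.2).

Definition trel r (xs : 'I_(rar r) -> point) : Prop :=
  sat (tr_rel K r) (fun p => xs p.1 p.2).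

Definition tfun f (xs : 'I_(far f) -> point) (y : point) : Prop :=
  sat (tr_fun K f) (fun p => oapp xs y p.1 p.2).

Fixpoint tval (V : Type) (t : term L V) (eps : V -> point) (x : point) : Prop :=
  match t with
  | Var v => eps v = x
  | App f ts => exists2 ys, (forall i, tdom (ys i) /\ tval (ts i) eps (ys i))
                          & tfun ys x
  end.

(** What a translated formula says about tuples of [M], before any quotient is available. The facts
    that make the quotient possible are read off from this form. *)
Fixpoint tsat (V : Type) (A : form L V) : (V -> point) -> Prop :=
  match A with
  | Bot => fun=> False
  | Eq s t => fun eps => exists x y,
      [/\ tdom x, tval s eps x, tdom y, tval t eps y & teq x y]
  | Rel r ts => fun eps =>
      exists2 ys, (forall i, tdom (ys i) /\ tval (ts i) eps (ys i)) & trel ys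
  | Imp A B => fun eps => tsat A eps -> tsat B eps
  | All A => fun eps => forall x, tdom x -> tsat A (oapp eps x)
  end.

Lemma tval_rename V W (f : V -> W) (t : term L V) eps x :
  tval (rename_term f t) eps x <-> tval t (eps \o f) x.
Proof.
elim: t x => [//|g ts IH] x /=.
by split=> -[ys ysP yx]; exists ys => // i; have [? /IH] := ysP i.
Qed.

Lemma tsat_evaluation : evaluation tdom tsat.
Proof.
split=> // V W f A; elim: A W f => {V}
  [//|V s t|V r ts|V A IHA B IHB|V A IHA] W f rho /=.
- by split=> -[x [y [? ? ? ? ?]]]; exists x, y; split=> //; apply/tval_rename.
- by split=> -[ys ysP ?]; exists ys => // i; have [? /tval_rename] := ysP i.
- by rewrite IHA IHB.
- have E d : oapp rho d \o omap f = oapp (rho \o f) d.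
    by apply: functional_extensionality; case.
  by split=> H d dd; have := H d dd; rewrite IHA E.
Qed.

Lemma sat_in_dom W (x : 'I_k -> W) (rho : W -> carrier M) :
  sat (in_dom K x) rho <-> tdom (rho \o x).
Proof. exact: sat_rename. Qed.

Lemma sat_tr_value V (t : term L V) W (e : V -> 'I_k -> W) x rho :
  sat (tr_value K t e x) rho <->
  tval t (fun v j => rho (e v j)) (fun j => rho (x j)).
Proof.
elim: t W e x rho => [v|f ts IH] W e x rho; first exact: sat_tuple_eq.
rewrite [tr_value _ _ _ _]/= [tval _ _ _]/=.
rewrite sat_ex_block; split=> [[g]|[ys ysP fx]].
  rewrite sat_And sat_AndN sat_rename => -[gP gf].
  exists (fun i j => g (i, j)) => [i|].
    by have := gP i; rewrite sat_And sat_in_dom IH.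
  by move: gf; congr sat; apply: functional_extensionality; case=> -[].
exists (fun p => ys p.1 p.2); rewrite sat_And sat_AndN sat_rename; split.
  by move=> i; rewrite sat_And sat_in_dom IH; apply: ysP.
by move: fx; congr sat; apply: functional_extensionality; case=> -[].
Qed.

Lemma sat_tr_form V (A : form L V) W (e : V -> 'I_k -> W) rho :
  sat (tr_form K A e) rho <-> tsat A (fun v j => rho (e v j)).
Proof.
elim: A W e rho => {V} [V|V s t|V r ts|V A IHA B IHB|V A IHA] W e rho.
- by [].
- rewrite [tr_form _ _ _]/= [tsat _ _]/=.
  rewrite sat_ex_block; split=> [[g]|[x [y [dx sx dy ty xy]]]].
    rewrite !sat_And !sat_in_dom !sat_tr_value sat_rename => -[[dx sx] [[dy ty] xy]].
    exists (fun j => g (false, j)), (fun j => g (true, j)); split=> //.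
    by move: xy; congr sat; apply: functional_extensionality; case=> -[].
  exists (fun p => if p.1 then y p.2 else x p.2).
  by rewrite !sat_And !sat_in_dom !sat_tr_value sat_rename.
- rewrite [tr_form _ _ _]/= [tsat _ _]/=.
  rewrite sat_ex_block; split=> [[g]|[ys ysP rys]].
    rewrite sat_And sat_AndN sat_rename => -[gP gr].
    exists (fun i j => g (i, j)) => [i|].
      by have := gP i; rewrite sat_And sat_in_dom sat_tr_value.
    by move: gr; congr sat; apply: functional_extensionality; case.
  exists (fun p => ys p.1 p.2); rewrite sat_And sat_AndN sat_rename; split=> //.
  by move=> i; rewrite sat_And sat_in_dom sat_tr_value; apply: ysP.
- by rewrite /= IHA IHB.
- have E g : (fun v j => copair rho g (if v is Some v' then inl (e v' j) else inr j))
             = oapp (fun v j => rho (e v j)) g.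
    by apply: functional_extensionality; case.
  rewrite [tr_form _ _ _]/= [tsat _ _]/= sat_all_block; split=> H g.
    by move=> dg; have := H g; rewrite /= sat_in_dom IHA E; apply.
  by rewrite /= sat_in_dom IHA E; apply: H.
Qed.

Lemma holds_tr_sentence (A : sentence L) :
  holds M (tr_sentence K A) <-> tsat A (of_void _).
Proof.
rewrite /holds /tr_sentence sat_tr_form.
by set eps := (X in tsat A X <-> _); rewrite (eq_from_void eps (of_void _)).
Qed.

(* [Q] is the internal model defined by [K] in [M], and [p] sends a tuple in
   the domain to the element of [Q] that it denotes. Only the image of [p] is
   asked for in [qm_fun], because a translation need not make the graph of a
   function symbol closed under [tr_eq]. *)
Record quotient_model (Q : structure L) (p : point -> carrier Q) : Prop :=
  QuotientModel {
    qm_onto : forall q, exists2 x, tdom x & p x = q;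
    qm_eq : forall x y, tdom x -> tdom y -> (teq x y <-> p x = p y);
    qm_rel : forall r (xs : 'I_(rar r) -> point), (forall i, tdom (xs i)) ->
      (trel xs <-> irel (fun i => p (xs i)));
    qm_fun : forall f (xs : 'I_(far f) -> point) y,
      (forall i, tdom (xs i)) -> tdom y -> tfun xs y ->
      p y = ifun (fun i => p (xs i));
    qm_total : forall f (xs : 'I_(far f) -> point),
      (forall i, tdom (xs i)) -> exists2 y, tdom y & tfun xs y
  }.

Section Truth.
Context (Q : structure L) (p : point -> carrier Q) (qm : quotient_model p).

Lemma tval_sound V (t : term L V) eps x : (forall v, tdom (eps v)) ->
  tdom x -> tval t eps x -> p x = teval t (p \o eps).
Proof.
move=> deps; elim: t x => [v|f ts IH] x dx /=; first by move=> <-.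
move=> [ys ysP fx]; rewrite (qm_fun qm _ _ fx) //; last by move=> i; case: (ysP i).
congr ifun; apply: functional_extensionality => i.
by have [dyi /IH] := ysP i; apply.
Qed.

Lemma tval_total V (t : term L V) eps : (forall v, tdom (eps v)) ->
  exists2 x, tdom x & tval t eps x.
Proof.
move=> deps; elim: t => [v|f ts IH] /=; first by exists (eps v).
have [|ys ysP] := functional_choice (R := fun i x => tdom x /\ tval (ts i) eps x).
  by move=> i; have [x] := IH i; exists x.
have [|y dy fy] := qm_total qm (f := f) (xs := ys); first by move=> i; case: (ysP i).
by exists y => //; exists ys.
Qed.

Theorem tsat_truth V (A : form L V) eps : (forall v, tdom (eps v)) ->
  (tsat A eps <-> sat A (p \o eps)).
Proof.
elim: A eps => {V} [//|V s t|V r ts|V A IHA B IHB|V A IHA] eps deps /=.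
- split=> [[x [y [dx sx dy ty /(qm_eq qm dx dy)]]]|E].
    by rewrite (tval_sound deps dx sx) (tval_sound deps dy ty).
  have [[x dx sx] [y dy ty]] := (tval_total s deps, tval_total t deps).
  exists x, y; split=> //; apply/(qm_eq qm) => //.
  by rewrite (tval_sound deps dx sx) (tval_sound deps dy ty).
- have E ys : (forall i, tdom (ys i) /\ tval (ts i) eps (ys i)) ->
      trel ys <-> irel (fun i => teval (ts i) (p \o eps)).
    move=> ysP; rewrite (qm_rel qm); last by move=> i; case: (ysP i).
    rewrite (_ : (fun i => p (ys i)) = fun i => teval (ts i) (p \o eps)) //.
    apply: functional_extensionality => i.
    by have [dy /(tval_sound deps dy)] := ysP i.
  split=> [[ys ysP /(E _ ysP)] //|H].
  have [|ys ysP] := functional_choice (R := fun i x => tdom x /\ tval (ts i) eps x).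
    by move=> i; have [x] := tval_total (ts i) deps; exists x.
  by exists ys => //; apply/E.
- by rewrite IHA // IHB.
- have E x : p \o oapp eps x = oapp (p \o eps) (p x).
    by apply: functional_extensionality; case.
  split=> H x.
    have [x' dx' <-] := qm_onto qm x; rewrite -E -IHA; first exact: H.
    by case.
  by move=> dx; rewrite IHA ?E //; case.
Qed.

Lemma holds_truth (A : sentence L) : holds M (tr_sentence K A) <-> holds Q A.
Proof. by rewrite holds_tr_sentence tsat_truth // sat_sentence. Qed.

End Truth.
End TranslationSemantics.

(** * Construction of the internal model *)

Section QuotientExists.
Context {k : nat} {L L' : signature} (K : translation k L L').
Context (T : theory L) (U : theory L') (KTU : is_interpretation K T U).
Context (M : structure L') (MU : models M U).

Local Notation tdom := (tdom K (M := M)).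
Local Notation teq := (teq K (M := M)).
Local Notation trel := (trel K (M := M)).
Local Notation tfun := (tfun K (M := M)).
Local Notation tsat := (tsat K (M := M)).
Let ev := tsat_evaluation K M.

Lemma tsat_proved (A : sentence L) : proves T A -> tsat A (of_void _).
Proof. by move=> /KTU /(sound MU); rewrite holds_tr_sentence. Qed.

(** By completeness a valid sentence is a theorem of [T], so its translation holds in [M]. This
    yields the equality, congruence and totality properties of [K] below without any derivation in
    [nd]. *)
Lemma tsat_valid (A : sentence L) :
  (forall Q : structure L, holds Q A) -> tsat A (of_void _).
Proof. by move=> QA; apply: tsat_proved; apply: complete => Q _. Qed.

Lemma tsat_eq V (u v : V) eps : tdom (eps u) -> tdom (eps v) ->
  (tsat (Eq (Var u) (Var v)) eps <-> teq (eps u) (eps v)).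
Proof.
move=> du dv; split=> [[x [y [_ <- _ <-]]] //|uv].
by exists (eps u), (eps v).
Qed.

Lemma tsat_rel V r (us : 'I_(rar r) -> V) eps : (forall i, tdom (eps (us i))) ->
  (tsat (Rel r (fun i => Var (us i))) eps <-> trel (fun i => eps (us i))).
Proof.
move=> dus; split=> [[ys ysP]|H]; last by exists (fun i => eps (us i)).
rewrite (_ : ys = fun i => eps (us i)) //.
by apply: functional_extensionality => i; case: (ysP i).
Qed.

(** The intermediate [y] cannot be replaced by [eps v], since the translated graph need not be
    closed under translated equality. *)
Lemma tsat_app V f (us : 'I_(far f) -> V) v eps :
  (forall i, tdom (eps (us i))) -> tdom (eps v) ->
  (tsat (Eq (App f (fun i => Var (us i))) (Var v)) eps <->
   exists y, [/\ tdom y, tfun (fun i => eps (us i)) y & teq y (eps v)]).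
Proof.
move=> dus dv; split=> [[y [z [dy [ys ysP fy] _ <- yz]]]|[y [dy fy yz]]].
  exists y; split=> //; rewrite (_ : (fun i => _) = ys) //.
  by apply: functional_extensionality => i; case: (ysP i).
by exists y, (eps v); split=> //; exists (fun i => eps (us i)).
Qed.

Lemma tdom_inhabited : exists x, tdom x.
Proof.
have /(ev_Ex ev)[x dx _] : tsat (Ex Top) (of_void _); last by exists x.
by apply: tsat_valid => Q; apply/sat_Ex; exists (some_point Q).
Qed.

Lemma teq_refl x : tdom x -> teq x x.
Proof.
move=> dx; have /(ev_All ev) /(_ x dx) : tsat (All (Eq (Var None) (Var None))) (of_void _).
  by apply: tsat_valid => Q d.
by rewrite tsat_eq.
Qed.

Lemma teq_euclid x y z : tdom x -> tdom y -> tdom z ->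
  teq x y -> teq x z -> teq y z.
Proof.
move=> dx dy dz.
pose A : sentence L := All (All (All (Imp (Eq (Var (Some (Some None))) (Var (Some None)))
  (Imp (Eq (Var (Some (Some None))) (Var None)) (Eq (Var (Some None)) (Var None)))))).
have : tsat A (of_void _) by apply: tsat_valid => Q a b c /= -> ->.
move=> /(ev_All ev) /(_ x dx) /(ev_All ev) /(_ y dy) /(ev_All ev) /(_ z dz).
by rewrite !(ev_Imp ev) !tsat_eq.
Qed.

Lemma trel_congr r (xs ys : 'I_(rar r) -> 'I_k -> carrier M) :
  (forall i, tdom (xs i)) -> (forall i, tdom (ys i)) ->
  (forall i, teq (xs i) (ys i)) -> trel xs -> trel ys.
Proof.
move=> dxs dys xys.
pose v b i : void + bool * 'I_(rar r) := inr (b, i).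
pose A : sentence L := all_block (I := (bool * 'I_(rar r))%type)
  (Imp (AndN (fun i => Eq (Var (v false i)) (Var (v true i))))
  (Imp (Rel r (fun i => Var (v false i))) (Rel r (fun i => Var (v true i))))).
have : tsat A (of_void _).
  apply: tsat_valid => Q; apply/sat_all_block => g.
  move=> /sat_AndN /= E; congr irel; exact: functional_extensionality.
move=> /(ev_all_block ev) /(_ (fun p => if p.1 then ys p.2 else xs p.2)).
rewrite !(ev_Imp ev) (ev_AndN ev) !tsat_rel //.
move=> H; apply: H => [[[] i]|i]; [exact: dys|exact: dxs|].
by rewrite tsat_eq /=.
Qed.

Lemma tfun_functional f (xs ys : 'I_(far f) -> 'I_k -> carrier M) x y :
  (forall i, tdom (xs i)) -> (forall i, tdom (ys i)) -> tdom x -> tdom y ->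
  (forall i, teq (xs i) (ys i)) -> tfun xs x -> tfun ys y -> teq x y.
Proof.
move=> dxs dys dx dy xys fx fy.
pose v b i : void + bool * option 'I_(far f) := inr (b, i).
pose A : sentence L := all_block (I := (bool * option 'I_(far f))%type)
  (Imp (AndN (fun i => Eq (Var (v false (Some i))) (Var (v true (Some i)))))
  (Imp (Eq (App f (fun i => Var (v false (Some i)))) (Var (v false None)))
  (Imp (Eq (App f (fun i => Var (v true (Some i)))) (Var (v true None)))
       (Eq (Var (v false None)) (Var (v true None)))))).
have : tsat A (of_void _).
  apply: tsat_valid => Q; apply/sat_all_block => g.
  move=> /sat_AndN /= E <- <-; congr ifun; exact: functional_extensionality.
move=> /(ev_all_block ev)
  /(_ (fun p => if p.1 then oapp ys y p.2 else oapp xs x p.2)).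
rewrite !(ev_Imp ev) (ev_AndN ev) !tsat_app // tsat_eq //; apply.
- by case=> -[] [].
- by move=> i; rewrite tsat_eq /=.
- by exists x; split=> //; apply: teq_refl.
- by exists y; split=> //; apply: teq_refl.
Qed.

Lemma tfun_total f (xs : 'I_(far f) -> 'I_k -> carrier M) :
  (forall i, tdom (xs i)) -> exists2 y, tdom y & tfun xs y.
Proof.
move=> dxs.
pose A : sentence L := all_block (I := 'I_(far f))
  (Ex (Eq (App f (fun i => Var (Some (inr i)))) (Var None))).
have : tsat A (of_void _).
  apply: tsat_valid => Q; apply/sat_all_block => g; apply/sat_Ex.
  by exists (ifun g).
move=> /(ev_all_block ev) /(_ xs dxs) /(ev_Ex ev)[z dz].
by rewrite tsat_app // => -[y [dy fy _]]; exists y.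
Qed.

Theorem quotient_model_exists :
  exists (Q : structure L) (p : ('I_k -> carrier M) -> carrier Q),
    quotient_model K p /\ models Q T.
Proof.
pose D := {x | tdom x}; pose R (x y : D) := teq (sval x) (sval y).
have [|x y z|Q [p [p_onto pE]]] := @quotient_exists D R.
- by move=> [x dx]; apply: teq_refl.
- by apply: teq_euclid; apply: svalP.
have [c cK] := functional_choice p_onto.
have [x0 dx0] := tdom_inhabited; pose d0 : D := exist _ x0 dx0.
(* The map to the quotient must be defined on all tuples; outside the domain it takes an arbitrary
   value, on which [quotient_model] puts no condition. *)
pose inD x : D := if excluded_middle_informative (tdom x) is left dx
                  then exist _ x dx else d0.
have inDK x : tdom x -> sval (inD x) = x.
  by move=> dx; rewrite /inD; case: excluded_middle_informative.
(* [h] selects one value in each graph; by [tfun_functional] every other value, even at merely equal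
   arguments, lies in the same class. *)
have [h hP] : exists h : forall f, ('I_(far f) -> D) -> D,
    forall f xs, tfun (fun i => sval (xs i)) (sval (h f xs)).
  have [h hP] := functional_choice (R := fun (fxs : {f : funs L & 'I_(far f) -> D}) (y : D) =>
      tfun (fun i => sval (projT2 fxs i)) (sval y))
    (fun fxs => let: existT f xs := fxs in
       let: ex_intro2 y dy fy := tfun_total (fun i => svalP (xs i)) in
       ex_intro _ (exist _ y dy) fy).
  by exists (fun f xs => h (existT _ f xs)) => f xs; exact: (hP (existT _ f xs)).
pose QM := Structure (p d0) (fun f qs => p (h f (fun i => c (qs i))))
             (fun r qs => trel (fun i => sval (c (qs i)))).
have cp x : tdom x -> teq x (sval (c (p (inD x)))).
  by move=> dx; rewrite -[x in teq x]inDK //; apply/pE.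
have pc x : tdom x -> teq (sval (c (p (inD x)))) x.
  by move=> dx; rewrite -[x in teq _ x]inDK //; apply/pE.
have qm : quotient_model (Q := QM) K (fun x => p (inD x)).
  split=> /= [q|x y dx dy|r xs dxs|f xs y dxs dy fy|f xs dxs].
  - have [[x dx] <-] := p_onto q; exists x => //; apply/pE.
    by rewrite /R inDK //; apply: teq_refl.
  - by rewrite pE /R !inDK.
  - by split; apply: trel_congr => // i; [exact: svalP|exact: cp|exact: svalP|exact: pc].
  - apply/pE; rewrite /R inDK //.
    apply: (tfun_functional _ _ _ _ _ fy (hP _ _)) => //.
    + by move=> i; apply: svalP.
    + exact: svalP.
    + by move=> i; apply: cp.
  - exact: tfun_total.
exists QM, (fun x => p (inD x)); split=> // A TA.
apply/(holds_truth qm)/(sound MU)/KTU.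
by apply: complete => Q'; apply.
Qed.

End QuotientExists.

Lemma teq_identity k (L L' : signature) (K : translation k L L')
    (M : structure L') (x y : 'I_k -> carrier M) :
  identity_preserving K -> (teq K x y <-> x = y).
Proof.
rewrite /teq => ->; rewrite sat_AndN /=; split=> [H|-> //].
exact: functional_extensionality.
Qed.

Lemma tdom_unrelativized k (L L' : signature) (K : translation k L L')
    (M : structure L') (x : 'I_k -> carrier M) : unrelativized K -> tdom K x.
Proof. by rewrite /tdom => ->. Qed.

(** * Composition with a one-dimensional direct interpretation *)

Section Composition.
Context {k : nat} {L1 L2 L3 : signature}.
Context (F : translation 1 L1 L2) (K : translation k L2 L3).

(** Domain and equality can be those of [K] because [F] will be unrelativized and
    identity-preserving. As [F] has dimension one, the second component of its variables carries no
    information and is dropped. *)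
Definition compose : translation k L1 L3 := {|
  tr_dim_gt0 := tr_dim_gt0 K;
  tr_dom := tr_dom K;
  tr_eq := tr_eq K;
  tr_rel := fun r => tr_form K (tr_rel F r) (fun p j => (p.1, j));
  tr_fun := fun f => tr_form K (tr_fun F f) (fun p j => (p.1, j))
|}.

Hypotheses (F_unrel : unrelativized F) (F_id : identity_preserving F).

Lemma quotient_model_compose (M : structure L3)
    (Q2 : structure L2) (p2 : ('I_k -> carrier M) -> carrier Q2)
    (Q1 : structure L1) (p1 : ('I_1 -> carrier Q2) -> carrier Q1) :
  quotient_model K p2 -> quotient_model F p1 ->
  quotient_model compose (fun x => p1 (fun=> p2 x)).
Proof.
move=> qm2 qm1.
have d1 (x : 'I_1 -> carrier Q2) : tdom F x by apply: tdom_unrelativized.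
have trelE r (xs : 'I_(rar r) -> 'I_k -> carrier M) :
    (forall i, tdom K (xs i)) ->
    trel compose xs <-> trel F (fun i (_ : 'I_1) => p2 (xs i)).
  move=> dxs; rewrite /trel sat_tr_form (tsat_truth qm2) // => -[i j] /=.
  exact: dxs.
have tfunE f (xs : 'I_(far f) -> 'I_k -> carrier M) y :
    (forall i, tdom K (xs i)) -> tdom K y ->
    tfun compose xs y <->
    tfun F (fun i (_ : 'I_1) => p2 (xs i)) (fun=> p2 y).
  move=> dxs dy; rewrite /tfun sat_tr_form (tsat_truth qm2); last first.
    by case=> -[i|] j /=; [apply: dxs|].
  by rewrite (_ : p2 \o _ = fun q => oapp (fun i (_ : 'I_1) => p2 (xs i))
    (fun=> p2 y) q.1 q.2) //; apply: functional_extensionality; case=> -[].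
split=> [q|x y dx dy|r xs dxs|f xs y dxs dy fy|f xs dxs].
- have [x _ <-] := qm_onto qm1 q; have [y dy yx] := qm_onto qm2 (x ord0).
  exists y => //; congr p1; apply: functional_extensionality => i.
  by rewrite ord1.
- rewrite -[teq _ _ _]/(teq K x y) (qm_eq qm2) // -(qm_eq qm1) // teq_identity //.
  by split=> [->|/(congr1 (@^~ ord0))].
- by rewrite trelE // (qm_rel qm1).
- by rewrite (qm_fun qm1 _ _ ((tfunE f xs y dxs dy).1 fy)).
- have [|z _ fz] := qm_total qm1 (f := f) (xs := fun i _ => p2 (xs i)) => //.
  have [y dy yz] := qm_onto qm2 (z ord0); exists y => //; apply/tfunE => //.
  rewrite (_ : (fun=> p2 y) = z) //; apply: functional_extensionality => i.
  by rewrite ord1.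
Qed.

Lemma is_interpretation_compose (T1 : theory L1) (T2 : theory L2)
    (T3 : theory L3) :
  is_interpretation F T1 T2 -> is_interpretation K T2 T3 ->
  is_interpretation compose T1 T3.
Proof.
move=> F12 K23 A T1A; apply: complete => M MT3.
have [Q2 [p2 [qm2 Q2T2]]] := quotient_model_exists K23 MT3.
have [Q1 [p1 [qm1 Q1T1]]] := quotient_model_exists F12 Q2T2.
apply/(holds_truth (quotient_model_compose qm2 qm1)); exact: sound T1A.
Qed.

End Composition.

(** * Reducts and expansions by a truth predicate *)

Section Reduct.
Context {L X : signature} (M : structure (sig_ext L X)).

Definition reduct : structure L :=
  Structure (some_point M) (fun f => @ifun _ M (inl f))
    (fun r => @irel _ M (inl r)).

Lemma teval_expand V (t : term L V) (rho : V -> carrier M) :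
  teval (M := M) (expand_term t) rho = teval (M := reduct) t rho.
Proof.
elim: t => [//|f ts IH] /=; congr ifun.
by apply: functional_extensionality => i; apply: IH.
Qed.

Lemma sat_expand V (A : form L V) (rho : V -> carrier M) :
  sat (M := M) (expand A) rho <-> sat (M := reduct) A rho.
Proof.
elim: A rho => {V} [//|V s t|V r ts|V A IHA B IHB|V A IHA] rho /=.
- by rewrite !teval_expand.
- rewrite (_ : (fun i => _) = fun i => teval (M := reduct) (ts i) rho) //.
  by apply: functional_extensionality => i; rewrite teval_expand.
- by rewrite IHA IHB.
- by split=> H d; apply/IHA; apply: H.
Qed.

Lemma models_add (U : theory L) (Gamma : theory (sig_ext L X)) :
  models M (add_theory U Gamma) <-> models reduct U /\ models M Gamma.
Proof.
split=> [MUG|[MU MG] A [[B UB ->]|/MG //]].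
  split=> A ?; last by apply: MUG; right.
  by rewrite /holds -sat_expand; apply: MUG; left; exists A.
by rewrite /holds sat_expand; apply: MU.
Qed.

End Reduct.

Section TruthExpansion.
Context {L : signature}.

Definition with_truth (M : structure L) k (T : ('I_k -> carrier M) -> Prop) :
    structure (sig_ext L (truth_sig k)) :=
  @Structure (sig_ext L (truth_sig k)) (carrier M) (some_point M)
    (fun f => match f with inl g => @ifun _ M g | inr v => match v with end end)
    (fun r => match r with inl s => @irel _ M s | inr _ => T end).

Definition truth_translation n m (phi : form (sig_ext L (truth_sig n)) 'I_m) :
    translation 1 (sig_ext L (truth_sig m)) (sig_ext L (truth_sig n)) := {|
  tr_dim_gt0 := isT : 0 < 1;
  tr_dom := Top;
  tr_eq := AndN (fun j => Eq (Var (false, j)) (Var (true, j)));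
  tr_rel := fun r : rels (sig_ext L (truth_sig m)) => match r with
    | inl s => @Rel (sig_ext L (truth_sig n)) _ (inl s) (fun i => Var (i, ord0))
    | inr _ => rename (fun i => (i, ord0)) phi
    end;
  tr_fun := fun f : funs (sig_ext L (truth_sig m)) => match f with
    | inl g => Eq (@App (sig_ext L (truth_sig n)) _ (inl g)
                     (fun i => Var (Some i, ord0))) (Var (None, ord0))
    | inr v => match v with end
    end
|}.

(** Here the internal model is explicit: [M] with its truth predicate exchanged for the one that
    [phi] defines. Its reduct to [L] is unchanged, so sentences of [L] keep their truth value. *)
Lemma truth_translation_quotient n m (phi : form (sig_ext L (truth_sig n)) 'I_m)
    (M : structure (sig_ext L (truth_sig n))) :
  quotient_model (truth_translation phi) (M := M)
    (Q := with_truth (M := reduct M) (@sat _ M _ phi)) (@^~ ord0).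
Proof.
split=> [q|x y _ _|[r|r] xs _|[f|[]] xs y _ _|[f|[]] xs _].
- by exists (fun=> q) => //; apply: tdom_unrelativized.
- rewrite teq_identity //; split=> [-> //|xy].
  by apply: functional_extensionality => i; rewrite ord1.
- by [].
- by rewrite /trel sat_rename.
- by rewrite /tfun /=.
- exists (fun=> @ifun _ M (inl f) (fun i => xs i ord0)); first exact: tdom_unrelativized.
  by rewrite /tfun /=.
Qed.

End TruthExpansion.

(** * Finite sets of tuples in Vaught set theory *)

(** The Kuratowski pair, as a relation: without extensionality in [VS] a pair may have many
    codes. *)
Definition pair_code (V : Type) (p a b : V) : form set_sig V :=
  let u := Some (Some None) in let v := Some None in let w := None in
  let old := fun x => Some (Some (Some x)) in
  Ex (Ex (And (All (Iff (mem_in w u) (Eq (Var w) (Var (old a)))))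
         (And (All (Iff (mem_in w v)
                        (Or (Eq (Var w) (Var (old a))) (Eq (Var w) (Var (old b))))))
              (All (Iff (mem_in w (old p))
                        (Or (Eq (Var w) (Var u)) (Eq (Var w) (Var v)))))))).

(** Nested pairs whose last tail is left arbitrary; recovering the components does not depend on
    it. *)
Fixpoint tuple_code (I V : Type) (l : seq I) (e : I -> V) (p : V) :
    form set_sig V :=
  if l is i :: l' then
    Ex (And (pair_code (Some p) (Some (e i)) None)
            (tuple_code l' (Some \o e) None))
  else Top.

Definition tuple_in (I : finType) : form set_sig (option I) :=
  Ex (And (mem_in None (Some None))
          (tuple_code (enum I) (fun i => Some (Some i)) None)).

Section SetModel.
Context (Q : structure set_sig).

Definition memQ (x y : carrier Q) : Prop :=
  irel (r := tt : rels set_sig) (fun i => if val i == 0 then x else y).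

Definition pairQ (p a b : carrier Q) : Prop := exists u v,
  [/\ forall w, memQ w u <-> w = a,
      forall w, memQ w v <-> w = a \/ w = b
    & forall w, memQ w p <-> w = u \/ w = v].

Fixpoint tupleQ (I : Type) (l : seq I) (z : I -> carrier Q) (p : carrier Q) :
    Prop :=
  if l is i :: l' then exists2 q, pairQ p (z i) q & tupleQ l' z q else True.

Lemma sat_mem_in V (x y : V) (rho : V -> carrier Q) :
  sat (mem_in x y) rho <-> memQ (rho x) (rho y).
Proof.
rewrite /mem_in /memQ /=; set f := (fun i => _); set g := (fun i => _).
by rewrite (_ : f = g) //; apply: functional_extensionality => i; rewrite /f /g; case: ifP.
Qed.

Lemma sat_pair_code V (p a b : V) (rho : V -> carrier Q) :
  sat (pair_code p a b) rho <-> pairQ (rho p) (rho a) (rho b).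
Proof.
rewrite /pair_code sat_Ex; split=> [[u]|[u [v [uP vP pP]]]].
  move=> /sat_Ex[v] /sat_And[/sat_All uP /sat_And[/sat_All vP /sat_All pP]].
  exists u, v.
  split=> w; [have := uP w|have := vP w|have := pP w];
    by rewrite sat_Iff sat_mem_in ?(ev_Or (sat_evaluation _)).
exists u; apply/sat_Ex; exists v; rewrite !sat_And !sat_All; split; [|split] => w;
  rewrite sat_Iff sat_mem_in ?(ev_Or (sat_evaluation _)) /=;
  by [apply: uP|apply: vP|apply: pP].
Qed.

Lemma sat_tuple_code I V (l : seq I) (e : I -> V) p (rho : V -> carrier Q) :
  sat (tuple_code l e p) rho <-> tupleQ l (rho \o e) (rho p).
Proof.
elim: l V e p rho => [|i l IH] V e p rho.
  by split=> // _; apply: (ev_Top (sat_evaluation Q)).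
rewrite [tuple_code _ _ _]/= sat_Ex [tupleQ _ _ _]/=.
split=> [[q]|[q piq lq]].
  by rewrite sat_And sat_pair_code IH => -[piq lq]; exists q.
by exists q; rewrite sat_And sat_pair_code IH.
Qed.

Lemma sat_tuple_in (I : finType) (s : carrier Q) (z : I -> carrier Q) :
  sat (tuple_in I) (oapp z s) <-> exists2 p, memQ p s & tupleQ (enum I) z p.
Proof.
rewrite /tuple_in sat_Ex; split=> [[p]|[p ps zp]].
  by rewrite sat_And sat_mem_in sat_tuple_code => -[ps zp]; exists p.
by exists p; rewrite sat_And sat_mem_in sat_tuple_code.
Qed.

(** The Kuratowski argument survives without extensionality, because both descriptions concern the
    same object [p]: each of [u'] and [v'] is literally [u] or [v]. *)
Lemma pairQ_inj p a b c d : pairQ p a b -> pairQ p c d -> a = c /\ b = d.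
Proof.
move=> [u [v [uP vP pP]]] [u' [v' [uP' vP' pP']]].
have au : memQ a u by apply/uP.
have cu : memQ c u' by apply/uP'.
have av : memQ a v by apply/vP; left.
have bv : memQ b v by apply/vP; right.
have dv : memQ d v' by apply/vP'; right.
have ac : a = c.
  have : memQ u' p by apply/pP'; left.
  move=> /pP[u'u|u'v]; first by symmetry; apply/uP; rewrite -u'u.
  by apply/uP'; rewrite u'v.
split=> //; subst c.
have : memQ v p by apply/pP; right.
move=> /pP'[vu'|vv'].
  have -> : b = a by apply/uP'; rewrite -vu'.
  have : memQ v' p by apply/pP'; right.
  move=> /pP[v'u|v'v]; symmetry; first by apply/uP; rewrite -v'u.
  by apply/uP'; rewrite -vu' -v'v.
subst v'; move: dv bv => /vP dv /vP' bv.
by case: dv bv => [->|-> _] // [->|->].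
Qed.

Lemma tupleQ_inj (I : eqType) (l : seq I) z z' p :
  tupleQ l z p -> tupleQ l z' p -> {in l, z =1 z'}.
Proof.
elim: l p => [//|i l IH] p /= [q piq lq] [q' piq' lq'] j.
have [E qq'] := pairQ_inj piq piq'; subst q'.
by rewrite inE => /orP[/eqP ->|/(IH _ lq lq')].
Qed.

Hypothesis QVS : models Q VS.

Lemma finite_set (l : seq (carrier Q)) :
  exists x, forall y, memQ y x <-> List.In y l.
Proof.
have nthE y : (exists i : 'I_(size l), y = nth y l i) <-> List.In y l.
  elim: l => [|a l IH] /=; first by split=> // -[[]].
  rewrite -IH; split=> [[[[|i] il] /=]|[->|[i yi]]].
  - by left.
  - by right; exists (Ordinal (il : i < size l)).
  - by exists ord0.
  - by exists (lift ord0 i).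
have := QVS (VS_set (size l)).
(* The default of [nth] is never reached, and repetitions in [l] do no harm, as the axiom does not
   ask for distinct elements. *)
move=> /sat_all_block /(_ (fun i => nth (some_point Q) l i)) /sat_Ex[x /sat_All xP].
exists x => y; rewrite -nthE; have := xP y.
rewrite sat_Iff sat_mem_in sat_OrN => -> /=.
by split=> -[i ->]; exists i; apply: set_nth_default.
Qed.

Lemma pairQ_total a b : exists p, pairQ p a b.
Proof.
have [[u uP] [v vP]] := (finite_set [:: a], finite_set [:: a; b]).
have [p pP] := finite_set [:: u; v].
exists p, u, v; split=> w; rewrite ?uP ?vP ?pP /=;
  by split; [do ?case=> //; auto|]; case; auto.
Qed.

Lemma tupleQ_total (I : Type) (l : seq I) z : exists p, tupleQ l z p.
Proof.
elim: l => [|i l [q lq]] /=; first by exists (some_point Q).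
by have [p piq] := pairQ_total (z i) q; exists p, q.
Qed.

End SetModel.

(** A set is a [k]-tuple of elements, [k] being the dimension of the interpretation of [VS]. One
    formula [phi] serves all models and all finite lists. *)
Theorem Vaught_coding (L : signature) (U : theory L) (I : finType) :
  Vaught U -> exists k, exists phi : form L ('I_k + I),
    forall M : structure L, models M U ->
    forall zs : seq (I -> carrier M), exists f : 'I_k -> carrier M,
    forall z, sat phi (copair f z) <-> List.In z zs.
Proof.
move=> [k [K [K_unrel K_id KVS]]]; exists k.
exists (tr_form K (tuple_in I)
          (fun o j => if o is Some i then inr i else inl j)) => M MU zs.
have [Q [p [qm QVS]]] := quotient_model_exists KVS MU.
have dK x : tdom K (M := M) x by apply: tdom_unrelativized.
(* An element of [M] enters the set theory as a constant [k]-tuple, which is in the domain because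
   [K] is unrelativized. *)
pose dQ z (i : I) := p (fun=> z i).
(* Codes are not unique, so one is fixed for each tuple and the set collects only these; a tuple
   with any code in the set is then one of the listed ones, by [tupleQ_inj]. *)
have [c cP] := functional_choice (fun z => tupleQ_total QVS (enum I) (dQ z)).
have [s sP] := finite_set QVS (map c zs).
have [f _ fs] := qm_onto qm s; exists f => z.
rewrite sat_tr_form (tsat_truth qm) // (_ : p \o _ = oapp (dQ z) s); last first.
  by apply: functional_extensionality; case=> //=; rewrite -fs.
rewrite sat_tuple_in; split=> [[q]|zzs]; last first.
  by exists (c z) => //; apply/sP; apply: List.in_map.
move=> /sP /List.in_map_iff[z' [<- z'zs]] zq.
rewrite (_ : z = z') //; apply: functional_extensionality => i.
have := tupleQ_inj zq (cP z') (mem_enum I i).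
rewrite /dQ -(qm_eq qm) // teq_identity //.
(* Identity preservation makes the constant tuples equal; a component exists as the dimension is
   positive. *)
by move=> /(congr1 (@^~ (Ordinal (tr_dim_gt0 K)))).
Qed.

(** * Chains between two models of Succ0 *)

Section SuccModel.
Context (Q : structure succ_sig).

Definition succQ (x y : carrier Q) : Prop :=
  irel (r := tt : rels succ_sig) (fun i => if val i == 0 then x else y).

Fixpoint numeralQ (q : nat) (x : carrier Q) : Prop :=
  if q is q'.+1 then exists2 y, numeralQ q' y & succQ y x
  else x = ifun (f := tt : funs succ_sig) (ord0_elim _).

Lemma sat_succ V (x y : V) (rho : V -> carrier Q) :
  sat (succ (Var x) (Var y)) rho <-> succQ (rho x) (rho y).
Proof.
rewrite /succ /succQ /=; set f := (fun i => _); set g := (fun i => _).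
rewrite (_ : f = g) //; apply: functional_extensionality => i.
by rewrite /f /g; case: ifP.
Qed.

Lemma sat_numeral q V (x : V) (rho : V -> carrier Q) :
  sat (numeral q x) rho <-> numeralQ q (rho x).
Proof.
elim: q V x rho => [|q IH] V x rho.
  rewrite /= (_ : (fun i => _) = ord0_elim (carrier Q)) //.
  by apply: functional_extensionality; case.
rewrite [numeral _ _]/= sat_Ex; split=> [[y]|[y yq yx]].
  by rewrite sat_And sat_succ IH => -[yq yx]; exists y.
by exists y; rewrite sat_And sat_succ IH.
Qed.

Hypothesis QS : models Q Succ0.

Lemma numeralQ_exists q : exists x, numeralQ q x.
Proof.
by have /sat_Ex[x /sat_numeral] := QS (Succ0_exists q); exists x.
Qed.

Lemma numeralQ_unique q x y : numeralQ q x -> numeralQ q y -> x = y.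
Proof.
move=> qx qy; have := QS (Succ0_unique q).
rewrite /holds sat_All => /(_ x); rewrite sat_All => /(_ y).
rewrite (ev_Imp (sat_evaluation _)) sat_And !sat_numeral; exact.
Qed.

Lemma numeralQ_inj q q' x : numeralQ q x -> numeralQ q' x -> q = q'.
Proof.
have disj i j : i < j -> numeralQ i x -> numeralQ j x -> False.
  move=> ij; have := QS (Succ0_disjoint ij); rewrite /holds sat_All => /(_ x).
  by rewrite sat_Neg sat_And !sat_numeral /= => H ? ?; apply: H.
by move=> qx q'x; case: (ltngtP q q') => // /disj; case.
Qed.

End SuccModel.

Section Chains.
Context (A B : structure succ_sig).
Hypotheses (AS : models A Succ0) (BS : models B Succ0).

(* The walk through [R] that starts at zero stops exactly at [b], and there it
   has reached [a]. *)
Definition chain (R : carrier A -> carrier B -> Prop) a b : Prop :=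
  [/\ exists x y, [/\ R x y, numeralQ 0 x & numeralQ 0 y],
      forall x y, R x y ->
        y = b \/ exists x' y', [/\ R x' y', succQ x x' & succQ y y']
    & forall x y, R x y -> y = b -> x = a].

(** For [i] below [q] the walk cannot stop, since the [i]-th numeral of [B] is not [b]; at step [q]
    it is at [b] by uniqueness. Both components count the same steps, so [a] is reached as the
    [q]-th numeral of [A]. *)
Lemma chain_numeral R a b q : chain R a b -> numeralQ q b -> numeralQ q a.
Proof.
move=> [R0 Rstep Rlast] qb.
have walk i : i <= q -> exists x y, [/\ R x y, numeralQ i x & numeralQ i y].
  elim: i => [//|i IH] iq; have [x [y [Rxy ix iy]]] := IH (ltnW iq).
  case: (Rstep x y Rxy) => [yb|[x' [y' [Rxy' xx' yy']]]].
    by subst y; move: iq; rewrite (numeralQ_inj BS iy qb) ltnn.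
  by exists x', y'; split=> //; [exists x|exists y].
have [x [y [Rxy qx qy]]] := walk q (leqnn q).
by rewrite -(Rlast x y Rxy) //; apply: (numeralQ_unique BS) qy qb.
Qed.

Lemma chain_exists a b q : numeralQ q a -> numeralQ q b ->
  exists l : seq (carrier A * carrier B),
    chain (fun x y => List.In (x, y) l) a b.
Proof.
move=> qa qb.
(* Strengthened for the induction: the walk stops only at the pair [(a, b)] itself, and both
   components of a pair denote the same numeral. The latter gives the last clause of [chain]: a pair
   ending in [b] has index [q], hence begins with [a]. *)
suff [l [l0 lstep lnum]] : exists l : seq (carrier A * carrier B),
    [/\ exists x y, [/\ List.In (x, y) l, numeralQ 0 x & numeralQ 0 y],
        forall x y, List.In (x, y) l -> (x, y) = (a, b) \/
          exists x' y', [/\ List.In (x', y') l, succQ x x' & succQ y y']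
      & forall x y, List.In (x, y) l ->
          exists i, numeralQ i x /\ numeralQ i y].
  exists l; split=> // x y xyl.
    by case: (lstep _ _ xyl) => [[_ ->]|]; [left|right].
  move=> yb; subst y; have [i [ix ib]] := lnum _ _ xyl.
  by move: ix; rewrite (numeralQ_inj BS ib qb) => /(numeralQ_unique AS); apply.
elim: q a b qa qb => [|q IH] a b qa qb.
  exists [:: (a, b)]; split; first by exists a, b; split=> //; left.
    by move=> x y /= [->|//]; left.
  by move=> x y /= [[<- <-]|//]; exists 0.
have [[a1 qa1 aa] [b1 qb1 bb]] := (qa, qb).
have [l [[x [y [xyl x0 y0]]] lstep lnum]] := IH _ _ qa1 qb1.
exists ((a, b) :: l); split.
- by exists x, y; split=> //; right.
- move=> {xyl x0 y0} {}x {}y /= [[<- <-]|xyl]; first by left.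
  (* The old end point is known to be exactly the pair of predecessors, so the new pair continues it
     in both components. *)
  right; case: (lstep _ _ xyl) => [[-> ->]|[x' [y' [xyl' xx' yy']]]].
    by exists a, b; split=> //; left.
  by exists x', y'; split=> //; right.
- move=> {xyl x0 y0} {}x {}y /= [[<- <-]|/lnum //]; by exists q.+1.
Qed.

End Chains.

(** * Transfer of the truth predicate *)

Section Transfer.
Context {L : signature} {n m k : nat}.
Context (N : translation n succ_sig L) (M : translation m succ_sig L).
Context (phi : form L ('I_k + ('I_n + 'I_m))).

(** A coded set may contain arbitrary tuples; the domain conditions discard those that denote no
    numbers. *)
Definition coded_pair W (f : 'I_k -> W) (y : 'I_n -> W) (x : 'I_m -> W) :
    form L W :=
  And (rename (copair f (copair y x)) phi) (And (in_dom N y) (in_dom M x)).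

Definition pair_eq d (K : translation d succ_sig L) W (x y : 'I_d -> W) :
    form L W :=
  tr_form K (Eq (Var false) (Var true)) (fun b => if b then y else x).

Definition pair_succ d (K : translation d succ_sig L) W (x y : 'I_d -> W) :
    form L W :=
  tr_form K (succ (Var false) (Var true)) (fun b => if b then y else x).

Definition chain_form W (f : 'I_k -> W) (a : 'I_n -> W) (b : 'I_m -> W) :
    form L W :=
  let old W' : W -> W + W' := inl in
  let y W' : 'I_n -> W' + ('I_n + 'I_m) := fun i => inr (inl i) in
  let x W' : 'I_m -> W' + ('I_n + 'I_m) := fun i => inr (inr i) in
  let pair W' (g : 'I_k -> W') :=
    coded_pair (inl \o g : 'I_k -> W' + ('I_n + 'I_m)) (y W') (x W') in
  And (ex_block (I := ('I_n + 'I_m)%type)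
        (And (pair W f) (And (tr_form N (numeral 0 tt) (fun=> y W))
                             (tr_form M (numeral 0 tt) (fun=> x W)))))
 (And (all_block (I := ('I_n + 'I_m)%type)
        (Imp (pair W f) (Or (pair_eq M (x W) (inl \o b))
          (ex_block (I := ('I_n + 'I_m)%type)
            (And (pair _ (inl \o f)) (And (pair_succ N (inl \o y W) (y _))
                                          (pair_succ M (inl \o x W) (x _))))))))
      (all_block (I := ('I_n + 'I_m)%type)
        (Imp (pair W f) (Imp (pair_eq M (x W) (inl \o b))
                             (pair_eq N (y W) (inl \o a)))))).

(* The truth predicate at [M]-numbers: a coded chain matches the argument with
   an [N]-number that satisfies the given truth predicate. *)
Definition transfer : form (sig_ext L (truth_sig n)) 'I_m :=
  ex_block (I := ('I_k + 'I_n)%type)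
    (And (expand (in_dom N (fun i => inr (inr i))))
    (And (expand (chain_form (fun i => inr (inl i)) (fun i => inr (inr i)) inl))
         (truth_atom (fun i => inr (inr i))))).

Section Semantics.
Context (S : structure L) (A B : structure succ_sig).
Context (pA : ('I_n -> carrier S) -> carrier A) (qmA : quotient_model N pA).
Context (pB : ('I_m -> carrier S) -> carrier B) (qmB : quotient_model M pB).

Definition coded (f : 'I_k -> carrier S) (y : 'I_n -> carrier S)
    (x : 'I_m -> carrier S) : Prop :=
  [/\ sat phi (copair f (copair y x)), tdom N y & tdom M x].

(** The passage from tuples to the numbers they denote; [chain] is stated for these, so the choice
    of representatives in a coded set is immaterial. *)
Definition coded_graph f (a : carrier A) (b : carrier B) : Prop :=
  exists y x, [/\ coded f y x, pA y = a & pB x = b].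

Lemma sat_coded_pair W f y x (rho : W -> carrier S) :
  sat (coded_pair f y x) rho <-> coded (rho \o f) (rho \o y) (rho \o x).
Proof.
rewrite !sat_And !sat_in_dom sat_rename /coded.
rewrite (_ : rho \o copair f (copair y x) =
             copair (rho \o f) (copair (rho \o y) (rho \o x))); last first.
  by apply: functional_extensionality; case=> // -[].
by split=> [[? [? ?]]|[? ? ?]].
Qed.

Lemma sat_pair_eq d (K : translation d succ_sig L) (Q : structure succ_sig)
    (p : ('I_d -> carrier S) -> carrier Q) W x y (rho : W -> carrier S) :
  quotient_model K p -> tdom K (rho \o x) -> tdom K (rho \o y) ->
  (sat (pair_eq K x y) rho <-> p (rho \o x) = p (rho \o y)).
Proof. by move=> qm dx dy; rewrite sat_tr_form (tsat_truth qm) //; case. Qed.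

Lemma sat_pair_succ d (K : translation d succ_sig L) (Q : structure succ_sig)
    (p : ('I_d -> carrier S) -> carrier Q) W x y (rho : W -> carrier S) :
  quotient_model K p -> tdom K (rho \o x) -> tdom K (rho \o y) ->
  (sat (pair_succ K x y) rho <-> succQ (p (rho \o x)) (p (rho \o y))).
Proof.
by move=> qm dx dy; rewrite sat_tr_form (tsat_truth qm) ?sat_succ //; case.
Qed.

Lemma sat_tr_numeral d (K : translation d succ_sig L) (Q : structure succ_sig)
    (p : ('I_d -> carrier S) -> carrier Q) q W (x : 'I_d -> W) rho :
  quotient_model K p -> tdom K (rho \o x) ->
  (sat (tr_form K (numeral q tt) (fun=> x)) rho <-> numeralQ q (p (rho \o x))).
Proof.
by move=> qm dx; rewrite sat_tr_form (tsat_truth qm) // sat_numeral.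
Qed.

Lemma sat_chain_form W f a b (rho : W -> carrier S) :
  tdom N (rho \o a) -> tdom M (rho \o b) ->
  sat (chain_form f a b) rho <->
  chain (coded_graph (rho \o f)) (pA (rho \o a)) (pB (rho \o b)).
Proof.
move=> da db; rewrite /chain_form; cbv zeta beta.
have codedE W' (h : 'I_k -> W') rho' (g : 'I_n + 'I_m -> carrier S) :
    sat (coded_pair (inl \o h) (fun i => inr (inl i)) (fun i => inr (inr i)))
      (copair rho' g) <-> coded (rho' \o h) (g \o inl) (g \o inr).
  exact: sat_coded_pair.
split=> [/sat_And[C1 /sat_And[C2 C3]]|[C1 C2 C3]].
  split.
  - move: C1 => /sat_ex_block[g] /sat_And[/codedE c /sat_And].
    have [_ dy dx] := c.
    rewrite (sat_tr_numeral _ qmA) // (sat_tr_numeral _ qmB) // => -[y0 x0].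
    by do 2!eexists; split; [do 2!eexists; split; first exact: c| |].
  - move=> _ _ [y [x [c <- <-]]]; have [_ dy dx] := c.
    have := (sat_all_block _ _).1 C2 (copair y x).
    rewrite (ev_Imp (sat_evaluation S)) codedE => /(_ c).
    rewrite (ev_Or (sat_evaluation S)) (sat_pair_eq qmB) // => -[|]; first by left.
    move=> /sat_ex_block[g] /sat_And[/codedE c' /sat_And].
    have [_ dy' dx'] := c'.
    rewrite (sat_pair_succ qmA) // (sat_pair_succ qmB) // => -[yy' xx'].
    by right; do 2!eexists; split; [do 2!eexists; split; first exact: c'| |].
  - move=> _ _ [y [x [c <- <-]]]; have [_ dy dx] := c.
    have := (sat_all_block _ _).1 C3 (copair y x).
    rewrite (ev_Imp (sat_evaluation S)) codedE => /(_ c).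
    rewrite (ev_Imp (sat_evaluation S)).
    by rewrite (sat_pair_eq qmB) // (sat_pair_eq qmA).
apply/sat_And; split; [|apply/sat_And; split].
- have [_ [_ [[y [x [c <- <-]]] y0 x0]]] := C1; have [_ dy dx] := c.
  apply/sat_ex_block; exists (copair y x).
  apply/sat_And; split; [exact/codedE|apply/sat_And].
  by rewrite (sat_tr_numeral _ qmA) // (sat_tr_numeral _ qmB).
- apply/sat_all_block => g; rewrite (ev_Imp (sat_evaluation S)) codedE => c.
  have [_ dy dx] := c; rewrite (ev_Or (sat_evaluation S)) (sat_pair_eq qmB) //.
  have [||[_ [_ [[y' [x' [c' <- <-]]] yy' xx']]]] :=
    C2 (pA (g \o inl)) (pB (g \o inr)); first by exists (g \o inl), (g \o inr).
    by left.
  have [_ dy' dx'] := c'.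
  right; apply/sat_ex_block; exists (copair y' x').
  apply/sat_And; split; [exact/codedE|apply/sat_And].
  by rewrite (sat_pair_succ qmA) // (sat_pair_succ qmB).
- apply/sat_all_block => g; rewrite (ev_Imp (sat_evaluation S)) codedE => c.
  have [_ dy dx] := c; rewrite (ev_Imp (sat_evaluation S)).
  rewrite (sat_pair_eq qmB) // (sat_pair_eq qmA) // => E.
  by apply: C3 E; exists (g \o inl), (g \o inr).
Qed.

End Semantics.

(** The truth predicate stays a condition on the tuple [y] and not on [pA y], as it may distinguish
    tuples denoting the same number. *)
Lemma holds_truth_num (S : structure (sig_ext L (truth_sig n)))
    (A : structure succ_sig) (pA : ('I_n -> carrier S) -> carrier A) q :
  quotient_model (M := reduct S) N pA ->
  holds S (truth_num N q) <->
  exists y, [/\ tdom N (M := reduct S) y, numeralQ q (pA y)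
              & @irel _ S (inr tt) y].
Proof.
move=> qm; rewrite /holds /truth_num sat_ex_block.
split=> [[y]|[y [dy qy Ty]]].
  rewrite !sat_And !sat_expand sat_in_dom => -[dy].
  by rewrite (sat_tr_numeral _ qm) // => -[qy Ty]; exists y.
exists y; rewrite !sat_And !sat_expand sat_in_dom; split=> //.
by rewrite (sat_tr_numeral _ qm).
Qed.

End Transfer.

(** This holds for an arbitrary predicate in [S] and every standard [q]; no truth axioms enter. A
    chain found in the model gives one direction by [chain_numeral]; the other needs a coded set for
    the list of [chain_exists]. *)
Lemma transfer_truth (L : signature) n m k (N : translation n succ_sig L)
    (M : translation m succ_sig L) (phi : form L ('I_k + ('I_n + 'I_m)))
    (S : structure (sig_ext L (truth_sig n)))
    (A B : structure succ_sig) (pA : ('I_n -> carrier S) -> carrier A)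
    (pB : ('I_m -> carrier S) -> carrier B) q :
  (forall zs : seq ('I_n + 'I_m -> carrier S), exists f : 'I_k -> carrier S,
     forall z, sat (M := reduct S) phi (copair f z) <-> List.In z zs) ->
  models A Succ0 -> models B Succ0 ->
  quotient_model (M := reduct S) N pA -> quotient_model (M := reduct S) M pB ->
  holds (with_truth (M := reduct S) (@sat _ S _ (transfer N M phi)))
        (truth_num M q) <->
  holds S (truth_num N q).
Proof.
move=> phiP AS BS qmA qmB; rewrite (holds_truth_num _ qmA).
set S' := with_truth _.
have qmB' : quotient_model (M := reduct S') M pB by [].
rewrite (holds_truth_num (S := S') _ qmB').
split=> [[x [dx qx Tx]]|[y [dy qy Ty]]].
  have /sat_ex_block[g] : sat (M := S) (transfer N M phi) x := Tx.
  move=> /sat_And[/sat_expand /sat_in_dom dy /sat_And[/sat_expand xy Ty]].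
  move: xy; rewrite (sat_chain_form _ qmA qmB) // => xy.
  exists (g \o inr); split=> //; exact: chain_numeral xy qx.
have [b qb] := numeralQ_exists BS q.
have [x dx xb] := qm_onto qmB b; subst b.
exists x; split=> //; suff: sat (M := S) (transfer N M phi) x by [].
apply/sat_ex_block.
have [l lP] := chain_exists AS BS qy qb.
(* The chain consists of numbers, but only tuples can be coded: [r] fixes representatives for each
   pair. *)
have [r rP] : exists r : carrier A * carrier B -> ('I_n + 'I_m -> carrier S),
    forall u, [/\ tdom N (M := reduct S) (r u \o inl),
      tdom M (M := reduct S) (r u \o inr),
      pA (r u \o inl) = u.1 & pB (r u \o inr) = u.2].
  apply: (functional_choice (R := fun u z => [/\ tdom N (M := reduct S) (z \o inl),
      tdom M (M := reduct S) (z \o inr),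
      pA (z \o inl) = u.1 & pB (z \o inr) = u.2])) => -[a b].
  have [[v dv <-] [w dw <-]] := (qm_onto qmA a, qm_onto qmB b).
  by exists (copair v w).
have [f fP] := phiP (map r l).
(* The given [y] is reused, not a chosen representative of its number, because the truth predicate
   is known only at [y]. *)
exists (copair f y); apply/sat_And; split; first exact/sat_expand/sat_in_dom.
apply/sat_And; split=> //; apply/sat_expand.
rewrite (sat_chain_form _ qmA qmB) //.
rewrite (_ : coded_graph _ _ _ _ _ _ = fun a b => List.In (a, b) l) //.
apply: functional_extensionality => a; apply: functional_extensionality => b.
apply: propositional_extensionality; split=> [|abl].
  move=> [y' [x' [[/fP /List.in_map_iff[[a' b'] [E abl]] _ _] <- <-]]].
  have [_ _] := rP (a', b').
  by rewrite E /= => -> ->.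
have [dy' dx' ya xb] := rP (a, b).
exists (r (a, b) \o inl), (r (a, b) \o inr); split=> //; split=> //.
have -> : copair (copair f y \o inl) (copair (r (a, b) \o inl) (r (a, b) \o inr))
    = copair f (r (a, b)).
  by apply: functional_extensionality; case=> // -[].
by apply/fP; apply: List.in_map.
Qed.

(** The sentences [B] of the scheme belong to [L], so the translation does not affect them, and
    their numbers are the same for [N] and [M]. Each instance for [M] thus becomes the instance for
    [N] by [transfer_truth]. *)
Lemma fujimoto_truth (L : signature) (U : theory L) n m
    (N : translation n succ_sig L) (M : translation m succ_sig L) :
  Vaught U -> is_interpretation N Succ0 U -> is_interpretation M Succ0 U ->
  fujimoto_interprets U (TBminus N) (TBminus M).
Proof.
move=> /(Vaught_coding ('I_n + 'I_m)%type)[k [phi phiP]] NU MU.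
exists (truth_translation (transfer N M phi)); split=> // A UA.
apply: complete => S /models_add[SU STB].
have [QN [pN [qmN QNS]]] := quotient_model_exists NU SU.
have [QM [pM [qmM QMS]]] := quotient_model_exists MU SU.
apply/(holds_truth (truth_translation_quotient (transfer N M phi) S)).
apply: sound UA; apply/models_add; split=> // _ [B ->].
have := STB _ (ex_intro _ B erefl); rewrite /holds !sat_Iff => SB.
rewrite sat_expand; rewrite sat_expand in SB.
rewrite -[sat (truth_num M _) _]/(holds _ _).
by rewrite (transfer_truth _ (phiP _ SU) QNS QMS qmN qmM).
Qed.

Theorem theorem3p4 (L : signature) (U : theory L) (n m : nat)
    (N : translation n succ_sig L) (M : translation m succ_sig L) :
  Vaught U ->
  is_interpretation N Succ0 U ->
  is_interpretation M Succ0 U ->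
  mutually_fujimoto_interpretable U (TBminus N) (TBminus M) /\
  (Enayat M U <-> Enayat N U).
Proof.
move=> VU NU MU.
have [NM MN] := (fujimoto_truth VU NU MU, fujimoto_truth VU MU NU).
have Enayat_transfer d d' (K : translation d succ_sig L)
    (K' : translation d' succ_sig L) :
    fujimoto_interprets U (TBminus K) (TBminus K') -> Enayat K U -> Enayat K' U.
  move=> [F [F_unrel F_id _ FU]] [e [E EU]]; exists e, (compose F E).
  exact: is_interpretation_compose FU EU.
by split; [|split; apply: Enayat_transfer].
Qed.
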